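(* For every $\varepsilon\in(0,1)$ and integer $d\ge 2$ there is $C_0$ such that for every $C\ge C_0$ the following holds. For every $n$, let $T$ be a tree on at most $(1-\varepsilon)n$ vertices with maximum degree $d$, let $G$ be a pseudorandom graph on $n$ vertices, and write $p:=C/n$. Suppose that $G_p$ is uniformly edge-coloured with $n$ colours. Then, with probability tending to $1$ as $n\to\infty$, $G_p$ contains a rainbow copy of $T$.
   Context: A graph $G$ on $n$ vertices is pseudorandom if for any two disjoint vertex subsets $A,B$ with $|A|\cdot|B|\ge 250n$ we have $e_G(A,B)\ge |A||B|/3$, where $e_G(A,B)$ is the number of edges of $G$ with one end in $A$ and the other in $B$. For $p\in[0,1]$, $G_p$ is the random subgraph of $G$ obtained by keeping each edge independently with probability $p$. Uniformly edge-coloured with $n$ colours: each edge independently gets a uniformly random colour from a fixed set of $n$ colours. Rainbow: all edges have distinct colours. *)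

(* Defs.v *)
From HB Require Import structures.
From mathcomp Require Import all_boot all_order all_algebra.
From mathcomp Require Import reals.

Set Implicit Arguments.
Unset Strict Implicit.
Unset Printing Implicit Defensive.

Import Order.TTheory GRing.Theory Num.Theory.

Local Open Scope nat_scope.

Record sgraph := SGraph {
  vertex :> finType;
  adj : rel vertex;
  adj_sym : symmetric adj;
  adj_irr : irreflexive adj }.

Definition edges (G : sgraph) : {set {set G}} :=
  [set e : {set G} | [exists x, exists y, adj x y && (e == [set x; y])]].

Definition degree (G : sgraph) (x : G) : nat := #|[set y | adj x y]|.

Definition max_degree (G : sgraph) : nat := \max_(x : G) degree x.

Definition graph_connected (G : sgraph) : Prop :=
  0 < #|G| /\ forall x y : G, connect (@adj G) x y.

(* [ucycle] accepts a single edge traversed back and forth as a cycle on two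
   vertices, so genuine cycles are those on at least three vertices. *)
Definition graph_acyclic (G : sgraph) : Prop :=
  forall s : seq G, ucycle (@adj G) s -> size s < 3.

Definition is_tree (G : sgraph) : Prop := graph_connected G /\ graph_acyclic G.

Definition edges_between (G : sgraph) (A B : {set G}) : nat :=
  #|[set e in edges G | [exists x in A, exists y in B, e == [set x; y]]]|.

Definition pseudorandom (G : sgraph) : Prop :=
  forall A B : {set G}, [disjoint A & B] ->
    250 * #|G| <= #|A| * #|B| ->
    #|A| * #|B| <= 3 * edges_between A B.

(* A spanning subgraph of a graph on V is represented by its edge set H.  An
   edge-colouring is a function on all subsets of V, of which only the values
   at the edges of H are ever used. *)

Definition rainbow (V K : finType) (c : {ffun {set V} -> K})
    (F : {set {set V}}) : bool :=
  [forall e1 in F, forall e2 in F, (c e1 == c e2) ==> (e1 == e2)].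

Definition copy_edges (T : sgraph) (V : finType) (f : {ffun T -> V}) :
  {set {set V}} := [set [set f x | x in e] | e : {set T} in edges T].

Definition has_rainbow_copy (T : sgraph) (V K : finType) (H : {set {set V}})
    (c : {ffun {set V} -> K}) : bool :=
  [exists f : {ffun T -> V},
    [&& injectiveb f, copy_edges f \subset H & rainbow c (copy_edges f)]].

Local Open Scope ring_scope.

(* The law of the pair (G_p, colouring): G_p = H with probability
   p^e(H) (1-p)^(e(G)-e(H)) for each H included in E(G), and the colouring is
   drawn independently and uniformly among all functions, that is, with
   independent uniform values; its restriction to H is therefore a uniform
   edge-colouring of H. *)
Definition coloured_Gp_prob (R : realType) (G : sgraph) (p : R) (K : finType)
    (Q : {set {set G}} -> {ffun {set G} -> K} -> bool) : R :=
  \sum_(H : {set {set G}} | H \subset edges G)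
    p ^+ #|H| * (1 - p) ^+ #|edges G :\: H| *
    (#|[set c | Q H c]|%:R / #|{ffun {set G} -> K}|%:R).

(* Main.v *)
Require Import Defs.
From HB Require Import structures.
From mathcomp Require Import all_boot all_order all_algebra.
From mathcomp Require Import boolp reals zify lra.

(** Cut T, rooted, into boundedly many connected pieces of small linear size and
    reserve a block of vertices of G, slightly larger than the piece, for each of
    them.  Inside one block G_p has far fewer edges than there are unused colours,
    so keeping one edge for each unused colour that occurs yields a rainbow graph
    in which, with overwhelming probability, any two large sets of vertices are
    joined by an edge.  The Friedman-Pippenger argument embeds the piece there,
    with its root at any vertex outside a small exceptional set.

    A piece is attached to the part embedded before by a single edge, which is
    found only with constant probability.  Therefore a large constant number of
    partial embeddings is carried along, whose attachment vertices are pairwise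
    distinct, so that the edges leaving them are independent: of every large
    group of these embeddings one can almost surely be extended. *)

(** With [p = C/n] a given vertex sends only boundedly many edges of [G_p] into a block, so no
    single attachment vertex can be relied on, and a failure probability that does not tend to 0
    would be paid at every piece. Carrying many embeddings at once is cheap: they may share
    vertices, edges and colours, since only one survives in the end. The properties required of it
    fail with exponentially small probability, and a union bound over boundedly many embeddings
    suffices.

    Independence is organised by revealing the coordinates of one product space in rounds. The edges
    inside a block come before the edges entering it from the attachment vertices, and these are
    revealed group by group. An embedding built so far uses revealed coordinates only, and therefore
    survives a resampling of the others.

    The number of pieces grows with [C]. This is what makes the argument work for every large [C],
    although a larger [C] also means more edges, hence more colours lost, in a block of given
    size. *)

Set Implicit Arguments.
Unset Strict Implicit.
Unset Printing Implicit Defensive.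

Import Order.TTheory GRing.Theory Num.Theory.

(** * Friedman-Pippenger tree embedding *)

Local Open Scope nat_scope.

Section Expansion.
Variables (V : finType) (e : rel V).

Definition nbrs (Y X : {set V}) : {set V} := [set y in Y | [exists x in X, e x y]].

Definition joined (a : nat) (W : {set V}) : Prop :=
  forall A B : {set V}, A \subset W -> B \subset W -> [disjoint A & B] ->
    a <= #|A| -> a <= #|B| -> exists x y, [/\ x \in A, y \in B & e x y].

Lemma in_nbrs (Y X : {set V}) x y : y \in Y -> x \in X -> e x y -> y \in nbrs Y X.
Proof. by move=> Yy Xx exy; rewrite inE Yy; apply/existsP; exists x; rewrite Xx. Qed.

Lemma nbrsP (Y X : {set V}) y :
  reflect (y \in Y /\ exists2 x, x \in X & e x y) (y \in nbrs Y X).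
Proof.
rewrite inE; apply: (iffP andP) => -[Yy].
  by move/existsP=> [x /andP[Xx exy]]; split=> //; exists x.
by move=> [x Xx exy]; split=> //; apply/existsP; exists x; rewrite Xx.
Qed.

Lemma nbrsU (Y X1 X2 : {set V}) : nbrs Y (X1 :|: X2) = nbrs Y X1 :|: nbrs Y X2.
Proof.
apply/setP=> y; apply/idP/idP.
  case/nbrsP=> Yy [x /setUP[X1x|X2x] exy]; apply/setUP; [left|right];
    exact: in_nbrs exy.
by case/setUP=> /nbrsP[Yy [x Xx exy]]; apply: (in_nbrs Yy _ exy);
  rewrite inE Xx ?orbT.
Qed.

Lemma nbrsS (Y X1 X2 : {set V}) : X1 \subset X2 -> nbrs Y X1 \subset nbrs Y X2.
Proof. by move=> /setUidPr <-; rewrite nbrsU subsetUl. Qed.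

Lemma joined_sub a (W W' : {set V}) : W' \subset W -> joined a W -> joined a W'.
Proof.
move=> sW'W jW A B sA sB; apply: jW; exact: subset_trans sW'W.
Qed.

Lemma joined_nbrs a (W X : {set V}) : joined a W -> X \subset W ->
  a <= #|X| -> #|W :\: X| < #|nbrs (W :\: X) X| + a.
Proof.
move=> jW sXW aX; rewrite ltnNge; apply/negP=> big.
have: a <= #|(W :\: X) :\: nbrs (W :\: X) X|.
  rewrite -(leq_add2l #|nbrs (W :\: X) X|) (leq_trans big) //.
  have sN : nbrs (W :\: X) X \subset W :\: X by apply/subsetP=> y /nbrsP[].
  by rewrite -(cardsID (nbrs (W :\: X) X) (W :\: X)) (setIidPr sN).
move=> aR.
have [] := jW X ((W :\: X) :\: nbrs (W :\: X) X) sXW _ _ aX aR.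
- by rewrite (subset_trans (subsetDl _ _)) ?subsetDl.
- by rewrite -setI_eq0; apply/eqP/setP=> x; rewrite !inE; case: (x \in X); rewrite ?andbF.
move=> x [y [Xx /setDP[WXy Ny] exy]].
by case/negP: Ny; apply: in_nbrs exy.
Qed.

(** Delete a largest set [Z] of at most [a] vertices that fails to expand by the factor [d + 1]. A
    non-expanding set in the remainder could be added to [Z], and the union would still fail to
    expand. *)
Lemma expanding_core d a (W : {set V}) : 0 < a -> joined a W ->
    (2 * d + 5) * a <= #|W| ->
  exists Y : {set V}, [/\ Y \subset W, #|W :\: Y| <= a,
    forall X : {set V}, X \subset Y -> #|X| <= a -> d.+1 * #|X| <= #|nbrs Y X|
  & forall X : {set V}, X \subset Y -> a <= #|X| -> #|Y| < #|nbrs Y X| + #|X| + a].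
Proof.
move=> a_gt0 jW Wbig.
pose small (Z : {set V}) := [&& Z \subset W, #|Z| <= a & #|nbrs (W :\: Z) Z| <= d.+1 * #|Z|].
have small0 : small set0.
  rewrite /small sub0set cards0 muln0 leqn0 cards_eq0 /=.
  by apply/eqP/setP=> y; rewrite in_set0; apply/negP=> /nbrsP[_ [x]]; rewrite inE.
have [Z /and3P[ZW Za ZN] Zmax] := arg_maxnP (fun Z : {set V} => #|Z|) small0.
have cW (X : {set V}) : X \subset W -> #|W :\: X| + #|X| = #|W|.
  by move=> sX; rewrite -(cardsID X W) (setIidPr sX) addnC.
exists (W :\: Z); split.
- exact: subsetDl.
- by rewrite setDDr setDv set0U (leq_trans _ Za) // subset_leq_card ?subsetIr.
- move=> X sX Xa; rewrite leqNgt; apply/negP=> Xn.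
  have dXZ : X :&: Z = set0.
    apply/setP=> x; rewrite !inE; apply/andP=> -[Xx Zx].
    by move/subsetP: sX => /(_ x Xx); rewrite !inE Zx.
  have cU : #|Z :|: X| = #|Z| + #|X| by rewrite setUC cardsU dXZ cards0 subn0 addnC.
  have sU : Z :|: X \subset W by rewrite subUset ZW (subset_trans sX) ?subsetDl.
  have nU : #|nbrs (W :\: (Z :|: X)) (Z :|: X)| <= d.+1 * #|Z :|: X|.
    rewrite cU mulnDr.
    apply: (@leq_trans (#|nbrs (W :\: Z) Z| + #|nbrs (W :\: Z) X|)); last first.
      by rewrite leq_add // ltnW.
    rewrite nbrsU; apply: leq_trans (leq_card_setU _ _) _.
    have sub X' : nbrs (W :\: (Z :|: X)) X' \subset nbrs (W :\: Z) X'.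
      apply/subsetP=> y /nbrsP[yin [x xX' exy]]; apply: (in_nbrs _ xX' exy).
      by move: yin; rewrite !inE negb_or => /andP[/andP[-> _] ->].
    by rewrite leq_add // subset_leq_card.
  have X_gt0 : 0 < #|X|.
    by rewrite lt0n; apply/eqP=> X0; rewrite X0 muln0 in Xn.
  (* Either [Z] was not maximal, or the union has between [a] and [2a] vertices and at most
     [2(d+1)a] neighbours outside. As fewer than [a] further vertices are missed, [W] would have
     fewer than [(2d+5)a] vertices. *)
  case: (leqP #|Z :|: X| a) => [le|gt].
    have := Zmax (Z :|: X); rewrite /small sU le nU => /(_ isT).
    by rewrite cU; lia.
  have := joined_nbrs jW sU (ltnW gt).
  have := cW _ sU; have : #|Z :|: X| <= 2 * a by rewrite cU; lia.
  by nia.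
move=> X sX aX.
have jY := joined_sub (subsetDl W Z) jW.
have := joined_nbrs jY sX aX.
set Y := W :\: Z; have : #|nbrs (Y :\: X) X| <= #|nbrs Y X|.
  apply/subset_leq_card/subsetP=> y /nbrsP[/setDP[Yy _] [x Xx exy]].
  exact: in_nbrs exy.
have : #|Y :\: X| + #|X| = #|Y| by rewrite -(cardsID X Y) (setIidPr sX) addnC.
lia.
Qed.

End Expansion.

(** * Extending an embedding by one vertex in an expanding graph *)

Section FriedmanPippenger.

(** For a set [X], [N] counts its free neighbours other than the new image [y], and [D], [D'] are
    its demands before and after the step. [b1] says that [y] is a free neighbour of [X], [b2] that
    [X] contains the image of the parent. So only a set that was already tight can be violated. *)
Lemma crit_arith (b1 b2 : bool) (N D D' : nat) :
  N < D' -> D <= b1 + N -> D' + b2 <= D -> [/\ b1, ~~ b2 & D = b1 + N].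
Proof. by case: b1; case: b2 => /= *; split=> //; lia. Qed.

Lemma union_arith (N1 N2 NU NI NI' D1 D2 DU DI : nat) :
  NI' <= NI -> NU + NI = N1 + N2 -> DU + DI = D1 + D2 -> DI <= NI' -> DU <= NU ->
  D1 = N1 -> D2 = N2 -> DU = NU.
Proof. lia. Qed.

Variables (V : finType) (e : rel V) (T : finType) (P : {set T}) (r : T)
  (par : T -> T) (depth : T -> nat) (d a : nat) (Y : {set V}).
Hypothesis a_gt0 : 0 < a.
Hypothesis rP : r \in P.
Hypothesis parP : forall v, v \in P -> v != r ->
  par v \in P /\ depth (par v) < depth v.
Hypothesis children_le : forall v, #|[set w in P :\ r | par w == v]| <= d.
Hypothesis small_exp :
  forall X : {set V}, X \subset Y -> #|X| <= a -> d.+1 * #|X| <= #|nbrs e Y X|.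
Hypothesis large_exp :
  forall X : {set V}, X \subset Y -> a <= #|X| -> #|Y| < #|nbrs e Y X| + #|X| + a.
Hypothesis room : #|P| + (2 * d + 3) * a <= #|Y|.

(* The number of free neighbours that X must still provide: one for each
   unembedded child of an embedded vertex of X, and d for every free vertex of X. *)
Definition demand (S : {set T}) (phi : T -> V) (X : {set V}) : nat :=
  #|[set w in P :\: S | (par w \in S) && (phi (par w) \in X)]|
    + d * #|X :\: phi @: S|.

(** The last clause reaches up to [2a], twice the range of [small_exp], so that it still applies to
    the union of two tight sets of at most [a] vertices. *)
Definition good (S : {set T}) (phi : T -> V) : Prop :=
  [/\ [/\ r \in S, S \subset P & forall v, v \in S -> v != r -> par v \in S],
      {in S &, injective phi},
      forall v, v \in S -> phi v \in Y,
      forall v, v \in S -> v != r -> e (phi (par v)) (phi v)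
    & forall X : {set V}, X \subset Y -> #|X| <= 2 * a ->
        demand S phi X <= #|nbrs e Y X :\: phi @: S|].

(** Demand is modular while the number of free neighbours is submodular; together they make tight
    sets closed under union. *)
Lemma demandUI (S : {set T}) (phi : T -> V) (X1 X2 : {set V}) :
  demand S phi (X1 :|: X2) + demand S phi (X1 :&: X2)
    = demand S phi X1 + demand S phi X2.
Proof.
rewrite /demand; set F := phi @: S.
set D := fun X : {set V} => [set w in P :\: S | (par w \in S) && (phi (par w) \in X)].
have -> : #|[set w in P :\: S | (par w \in S) && (phi (par w) \in X1 :|: X2)]| = #|D X1 :|: D X2|.
  by apply: eq_card => w; rewrite !inE; case: (w \in P); case: (w \in S); case: (par w \in S).
have -> : #|[set w in P :\: S | (par w \in S) && (phi (par w) \in X1 :&: X2)]| = #|D X1 :&: D X2|.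
  apply: eq_card => w; rewrite !inE.
  by case: (w \in P); case: (w \in S); case: (par w \in S); rewrite ?andbF.
rewrite setDUl setDIl.
have := cardsUI (D X1) (D X2); have := cardsUI (X1 :\: F) (X2 :\: F).
rewrite -/(D X1) -/(D X2); nia.
Qed.

Lemma demand_bound (S : {set T}) (phi : T -> V) (X : {set V}) : {in S &, injective phi} ->
  r \in S -> demand S phi X <= d * #|X|.
Proof.
move=> inj rS; rewrite /demand.
rewrite -(cardsID (phi @: S) X) mulnDr leq_add2r.
have -> : #|[set w in P :\: S | (par w \in S) && (phi (par w) \in X)]|
   = \sum_(v in [set v in S | phi v \in X]) #|[set w in P :\: S | par w == v]|.
  rewrite -sum1_card (partition_big par (mem [set v in S | phi v \in X])) /=.
    apply: eq_bigr => v; rewrite inE => /andP[vS vX].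
    rewrite -sum1_card; apply: eq_bigl => w; rewrite !inE.
    by case: eqP => [->|]; rewrite ?andbF ?vS ?vX ?andbT.
  by move=> w; rewrite !inE => /andP[_ /andP[-> ->]].
have -> : #|X :&: phi @: S| = #|[set v in S | phi v \in X]|.
  rewrite -(@card_in_imset _ _ phi [set v in S | phi v \in X]).
    apply: eq_card => x; rewrite inE; apply/andP/imsetP.
      by case=> Xx /imsetP[v vS xE]; exists v; rewrite ?inE ?vS -?xE.
    by case=> v; rewrite inE => /andP[vS vX] ->; split=> //; apply: imset_f.
  by move=> u v; rewrite !inE => /andP[uS _] /andP[vS _]; apply: inj.
rewrite mulnC -sum_nat_const; apply: leq_sum => v _.
apply: leq_trans (children_le v); apply: subset_leq_card; apply/subsetP=> w.
rewrite !inE => /andP[/andP[wS ->] ->]; rewrite !andbT.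
by apply: contraNneq wS => ->.
Qed.

Lemma good_root y : y \in Y -> good [set r] (fun=> y).
Proof.
move=> yY; split.
- by split=> [|| v]; rewrite ?inE ?sub1set ?rP // => ->.
- by move=> u v; rewrite !inE => /eqP-> /eqP->.
- by [].
- by move=> v; rewrite inE => ->.
move=> X sX X2a; apply: leq_trans (demand_bound _ _ _) _.
- by move=> u v; rewrite !inE => /eqP-> /eqP->.
- by rewrite inE.
rewrite imset_set1.
have [Xa|Xa] := leqP #|X| a.
  have := small_exp sX Xa; have : #|nbrs e Y X| <= #|nbrs e Y X :\: [set y]| + 1.
    by rewrite -(cardsID [set y] (nbrs e Y X)) addnC leq_add2l
      -(cards1 y) subset_leq_card ?subsetIr.
  case: (posnP #|X|) => [->|X0]; first by rewrite !muln0.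
  rewrite mulSn; lia.
have := large_exp sX (ltnW Xa); have : #|nbrs e Y X| <= #|nbrs e Y X :\: [set y]| + 1.
  by rewrite -(cardsID [set y] (nbrs e Y X)) addnC leq_add2l
      -(cards1 y) subset_leq_card ?subsetIr.
have : 0 < #|P| by apply/card_gt0P; exists r.
nia.
Qed.

(** Such an [X] has more than [|Y| - 3a], hence more than [|P| + 2da], neighbours. At most [|P|] of
    them are occupied, and the demand is at most [d|X|], so at most [2da]. The term [(2d+3)a] of
    [room] is chosen for this. *)
Lemma large_not_critical S phi (X : {set V}) : good S phi -> X \subset Y ->
  a < #|X| -> #|X| <= 2 * a -> demand S phi X < #|nbrs e Y X :\: phi @: S|.
Proof.
case=> -[rS SP _] inj _ _ _ sX aX X2a.
have := demand_bound X inj rS.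
have := large_exp sX (ltnW aX).
have : #|nbrs e Y X| <= #|nbrs e Y X :\: phi @: S| + #|P|.
  rewrite -(cardsID (phi @: S) (nbrs e Y X)) addnC leq_add2l.
  apply: leq_trans (subset_leq_card (subsetIr _ _)) _.
  by rewrite (leq_trans (leq_imset_card _ _)) ?subset_leq_card.
nia.
Qed.

(** A free neighbour [y] of [u] is unusable only if it is a neighbour of a tight set avoiding [u].
    Tight sets are closed under union, so a largest one, [Xm], contains all of them, and any free
    neighbour of [u] outside the neighbourhood of [Xm] will do. *)
Lemma good_extend S phi w0 : good S phi -> w0 \in P :\: S -> par w0 \in S ->
  exists2 y, y \notin phi @: S & good (w0 |: S) (fun v => if v == w0 then y else phi v).
Proof.
move=> gS /setDP[w0P w0S] pw0S; pose u := phi (par w0).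
case: (gS) => -[rS SP Spar] inj SY Se inv.
have uY : u \in Y by apply: SY.
set F := phi @: S.
pose upd y v := if v == w0 then y else phi v.
have updE y v : v \in S -> upd y v = phi v.
  by rewrite /upd; case: eqP => // ->; rewrite (negPf w0S).
have FE y : upd y @: (w0 |: S) = y |: F.
  rewrite imsetU1 /upd eqxx; congr (_ |: _).
  by apply: eq_in_imset => v vS; rewrite -/(upd y v) updE.
have w0r : w0 != r by apply: contraNneq w0S => ->.
(* If [y] lies in [X], its allowance [d] is replaced by the at most [d] children of [w0]. If [u]
   lies in [X], the request for [w0] itself has been met. *)
have demE y (X : {set V}) : y \notin F -> demand (w0 |: S) (upd y) X + (u \in X) <= demand S phi X.
  move=> yF; rewrite /demand FE -/F.
  set D := [set w in P :\: S | (par w \in S) && (phi (par w) \in X)].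
  set D' := [set w in P :\: (w0 |: S) | _].
  pose Ch := [set w in P :\ r | par w == w0].
  have sD' : D' \subset (D :\ w0) :|: (if y \in X then Ch else set0).
    apply/subsetP=> w; rewrite !inE negb_or => /andP[/andP[/andP[ww0 wS] wP]].
    case/andP=> /orP[/eqP pw|pw].
      rewrite pw /upd eqxx => ->; rewrite !inE wP pw eqxx.
      by rewrite (_ : w != r) ?orbT //; apply: contraNneq wS => ->.
    by rewrite updE // ww0 wS wP pw => ->.
  have D0 : #|D| = (u \in X) + #|D :\ w0|.
    by rewrite (cardsD1 w0 D) !inE w0S w0P pw0S.
  have := subset_leq_card sD'; have := (leq_card_setU (D :\ w0) (if y \in X then Ch else set0)).1.
  rewrite D0; case yX: (y \in X).
    have : #|Ch| <= d by apply: children_le.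
    have : #|X :\: F| = 1 + #|X :\: (y |: F)|.
      rewrite (cardsD1 y (X :\: F)) !inE yF yX; congr (_ + _).
      by apply: eq_card => x; rewrite !inE negb_or andbA.
    move=> -> h1 h2 h3; rewrite mulnDr muln1 (addnC (#|D'| + _)) -addnA leq_add2l.
    rewrite addnA leq_add2r (leq_trans h3) // (leq_trans h2) //.
    by rewrite leq_add2l.
  rewrite setU0 cards0.
  have -> : X :\: (y |: F) = X :\: F.
    apply/setP=> x; rewrite !inE negb_or; case: eqP => [->|//].
    by rewrite yX !andbF.
  move=> h2 h3; rewrite (addnC (#|D'| + _)) -addnA leq_add2l leq_add2r.
  by rewrite (leq_trans h3) // (leq_trans h2) // addn0.
have NE y (X : {set V}) : nbrs e Y X :\: (y |: F) = (nbrs e Y X :\: F) :\ y.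
  by apply/setP=> x; rewrite in_setD1 !in_setD in_setU1 negb_or andbA.
pose crit (X : {set V}) := [&& X \subset Y, #|X| <= a, u \notin X & demand S phi X == #|nbrs e Y X :\: F|].
have good_or_crit y : y \in nbrs e Y [set u] :\: F ->
    good (w0 |: S) (upd y) \/ exists2 X : {set V}, crit X & y \in nbrs e Y X.
  case/setDP=> /nbrsP[yY [u' /set1P->{u'} euy]] yF.
  have [/forallP/= allX|/forallPn[X]] := boolP [forall X : {set V},
      (X \subset Y) && (#|X| <= 2 * a) ==>
      (demand (w0 |: S) (upd y) X <= #|nbrs e Y X :\: (y |: F)|)].
    left; split.
    - split; first by rewrite !inE rS orbT.
        by rewrite subUset sub1set w0P.
      move=> v; rewrite !inE => /orP[/eqP->|vS vr]; first by rewrite pw0S orbT.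
      by rewrite Spar ?orbT.
    - have ney v : v \in S -> upd y v != y.
        by move=> vS; rewrite updE //; apply: contraNneq yF => <-; apply: imset_f.
      move=> v v'; rewrite !inE => /orP[/eqP->|vS] /orP[/eqP->|v'S] //.
      + by rewrite {1}/upd eqxx => E; have := ney _ v'S; rewrite -E eqxx.
      + by rewrite {2}/upd eqxx => E; have := ney _ vS; rewrite E eqxx.
      + by rewrite !updE //; apply: inj.
    - move=> v; rewrite !inE => /orP[/eqP->|vS]; first by rewrite /upd eqxx.
      by rewrite -/(upd y v) updE // SY.
    - move=> v; rewrite !inE => /orP[/eqP-> _|vS vr].
        by rewrite -/(upd y _) -/(upd y _) updE // {1}/upd eqxx.
      by rewrite -/(upd y _) -/(upd y _) !updE ?Spar // Se.
    - move=> X sX X2a; rewrite FE; have := allX X.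
      by rewrite sX X2a.
  rewrite negb_imply -ltnNge => /andP[/andP[sX X2a] bad].
  have inX := inv X sX X2a; have demX := demE y X yF.
  rewrite -/F (cardsD1 y (nbrs e Y X :\: F)) -NE in inX.
  have [yN uX cX] := crit_arith bad inX demX.
  right; exists X; last by case/setDP: yN.
  have crE : demand S phi X = #|nbrs e Y X :\: F|.
    by rewrite cX (cardsD1 y (nbrs e Y X :\: F)) NE.
  rewrite /crit sX crE eqxx uX !andbT /= leqNgt; apply/negP=> aX.
  by have := large_not_critical gS sX aX X2a; rewrite crE ltnn.
have crit0 : crit set0.
  rewrite /crit sub0set cards0 leq0n inE /=.
  have := inv set0 (sub0set _); rewrite cards0 => /(_ isT).
  have -> : nbrs e Y set0 = set0.
    by apply/setP=> z; rewrite in_set0; apply/negP=> /nbrsP[_ [x]]; rewrite inE.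
  by rewrite set0D cards0 leqn0.
have critU (X1 X2 : {set V}) : crit X1 -> crit X2 -> crit (X1 :|: X2).
  case/and4P=> s1 a1 u1 /eqP c1 /and4P[s2 a2 u2 /eqP c2].
  have sU : X1 :|: X2 \subset Y by rewrite subUset s1.
  have sI : X1 :&: X2 \subset Y by apply: subset_trans s1; apply: subsetIl.
  have lU : #|X1 :|: X2| <= 2 * a by apply: leq_trans (leq_card_setU _ _) _; rewrite mul2n -addnn leq_add.
  have lI : #|X1 :&: X2| <= 2 * a.
    by apply: leq_trans (subset_leq_card (subsetIl _ _)) _; rewrite (leq_trans a1) ?leq_pmull.
  have := inv _ sU lU; have := inv _ sI lI; have := demandUI S phi X1 X2.
  have := cardsUI (nbrs e Y X1 :\: F) (nbrs e Y X2 :\: F).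
  rewrite -setDUl -nbrsU -/F.
  have : #|nbrs e Y (X1 :&: X2) :\: F| <= #|(nbrs e Y X1 :\: F) :&: (nbrs e Y X2 :\: F)|.
    by rewrite -setDIl subset_leq_card // setSD // subsetI !nbrsS ?subsetIl ?subsetIr.
  move=> h1 h2 h3 h4 h5.
  have cE : demand S phi (X1 :|: X2) = #|nbrs e Y (X1 :|: X2) :\: F| by exact: union_arith h1 h2 h3 h4 h5 c1 c2.
  rewrite /crit sU cE eqxx inE negb_or u1 u2 !andbT /=.
  rewrite leqNgt; apply/negP=> aX.
  by have := large_not_critical gS sU aX lU; rewrite cE ltnn.
have [Xm critXm Xmax] := arg_maxnP (fun X : {set V} => #|X|) crit0.
(* In the first case adding [u] to [Xm] brings no new free neighbour but raises the demand, at least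
   by the request for [w0]; this contradicts the invariant. *)
have [sub|/subsetPn[y yN yX]] := boolP (nbrs e Y [set u] :\: F \subset nbrs e Y Xm).
  have /and4P[sX Xa uX /eqP cX] := critXm.
  have sU : Xm :|: [set u] \subset Y by rewrite subUset sX sub1set.
  have lU : #|Xm :|: [set u]| <= 2 * a.
    by apply: leq_trans (leq_card_setU _ _) _; rewrite cards1 mul2n -addnn leq_add.
  have := inv _ sU lU; have := demandUI S phi Xm [set u].
  have -> : Xm :&: [set u] = set0.
    by apply/setP=> x; rewrite !inE; case: eqP => [->|]; rewrite ?(negPf uX) ?andbF.
  have -> : nbrs e Y (Xm :|: [set u]) :\: phi @: S = nbrs e Y Xm :\: F.
    apply/setP=> x; rewrite nbrsU -/F !in_setD in_setU.
    case xF: (x \in F) => //=; case xX: (x \in nbrs e Y Xm) => //=.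
    by apply/negP=> xu; move/subsetP: sub => /(_ x); rewrite in_setD xF xu xX => /(_ isT).
  have : 0 < demand S phi [set u].
    rewrite /demand ltn_addr //; apply/card_gt0P; exists w0.
    by rewrite !inE w0P w0S pw0S eqxx.
  have : demand S phi set0 = 0.
    rewrite /demand set0D cards0 muln0 addn0; apply/eqP; rewrite cards_eq0.
    by apply/eqP/setP=> x; rewrite !inE !andbF.
  move=> -> pos; rewrite addn0 => ->; rewrite cX -[leqRHS]addn0 leq_add2l leqn0.
  by case: (demand _ _ _) pos.
exists y; first by case/setDP: yN.
case: (good_or_crit y yN) => // -[X critX yNX]; case/negP: yX.
have le : #|Xm :|: X| <= #|Xm| by apply: Xmax; apply: critU.
have <- : Xm :|: X = Xm by apply/esym/eqP; rewrite eqEcard subsetUl.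
by rewrite nbrsU inE yNX orbT.
Qed.

Lemma tree_embedding y : y \in Y ->
  exists phi : T -> V, [/\ phi r = y, {in P &, injective phi},
    forall v, v \in P -> phi v \in Y
  & forall v, v \in P -> v != r -> e (phi (par v)) (phi v)].
Proof.
move=> yY.
have ext k : k < #|P| -> exists S phi, [/\ good S phi, phi r = y & #|S| = k.+1].
  elim: k => [_|k IHk lt].
    by exists [set r], (fun=> y); rewrite cards1; split=> //; apply: good_root.
  have [S [phi [gS phir cS]]] := IHk (ltnW lt).
  have [[rS SP Spar] _ _ _ _] := gS.
  have [w wPS] : exists w, w \in P :\: S.
    by apply/card_gt0P; rewrite cardsD (setIidPr SP) subn_gt0 cS.
  have [w0 w0PS min] := arg_minnP depth wPS.
  have /setDP[w0P w0S] := w0PS.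
  have w0r : w0 != r by apply: contraNneq w0S => ->.
  have [pP pd] := parP w0P w0r.
  have pS : par w0 \in S.
    apply/negPn/negP=> pS; have /min : par w0 \in P :\: S by rewrite !inE pP pS.
    by rewrite leqNgt pd.
  have [z zF gS'] := good_extend gS w0PS pS.
  exists (w0 |: S), (fun v => if v == w0 then z else phi v); split=> //.
    by rewrite eq_sym (negPf w0r).
  by rewrite cardsU1 w0S cS.
have P_gt0 : 0 < #|P| by apply/card_gt0P; exists r.
have [|S [phi [gS phir cS]]] := ext #|P|.-1; first by rewrite prednK.
rewrite prednK // in cS.
have [[rS SP Spar] inj SY Se _] := gS.
have SE : S = P by apply/eqP; rewrite eqEcard SP cS leqnn.
by exists phi; rewrite -SE.
Qed.

End FriedmanPippenger.

(** * Rooted trees and their decomposition *)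

Local Open Scope nat_scope.

Lemma card_bigcup_leq (I T : finType) (P : pred I) (F : I -> {set T}) :
  #|\bigcup_(i | P i) F i| <= \sum_(i | P i) #|F i|.
Proof.
elim/big_rec2: _ => [|i m A _ IH]; first by rewrite cards0.
by rewrite (leq_trans (leq_card_setU _ _)) // leq_add2l.
Qed.

(** The root is its own parent, so that [par] can be iterated freely and [fconnect par w v] means
    that [w] descends from [v]. *)
Record rooted (T : finType) (rt : T) (par : T -> T) (depth : T -> nat) : Prop := Rooted {
  rooted_par_root : par rt = rt;
  rooted_depth : forall v, v != rt -> depth (par v) < depth v }.

Definition children (T : finType) (rt : T) (par : T -> T) (v : T) : {set T} :=
  [set w | (w != rt) && (par w == v)].

(** Parents are neighbours closer to the root. If an edge [xy] were not a parent edge, all parent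
    edges would survive its deletion, so [x] and [y] would remain connected through the root. A path
    between them without [xy] closes up to a cycle on at least three vertices. *)
Lemma tree_rooting (T : sgraph) : is_tree T ->
  exists (rt : T) (par : T -> T) (depth : T -> nat),
  [/\ rooted rt par depth, forall v, v != rt -> adj (par v) v
    & forall x y : T, adj x y -> (x != rt /\ par x = y) \/ (y != rt /\ par y = x)].
Proof.
case=> -[/card_gt0P[rt _] conn] acyc.
pose reach v k := [exists p : k.-tuple T, path (@adj T) rt p && (last rt p == v)].
have reachP v : exists k, reach v k.
  case/connectP: (conn rt v) => p pp ->; exists (size p).
  by apply/existsP; exists (in_tuple p); rewrite pp eqxx.
pose depth v := ex_minn (reachP v).
have depth_par v : v != rt -> exists u : T, adj u v && (depth u < depth v).
  move=> vrt; rewrite {2}/depth; case: ex_minnP => k /existsP[p /andP[pp /eqP lp]] _.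
  case: k p pp lp => [|k] p.
    by rewrite tuple0 /= => _ E; rewrite E eqxx in vrt.
  case: (lastP (tval p)) (size_tuple p) => [//|q w]; rewrite size_rcons => -[sq].
  rewrite rcons_path last_rcons => /andP[pq aw] wv; exists (last rt q).
  rewrite -wv aw /= ltnS /depth; case: ex_minnP => m _; apply.
  apply/existsP; have sq' : size q == k by apply/eqP.
  by exists (Tuple sq'); rewrite /= pq eqxx.
pose par v := if [pick u | adj u v && (depth u < depth v)] is Some u
  then (if v == rt then rt else u) else rt.
have parE v : v != rt -> adj (par v) v && (depth (par v) < depth v).
  move=> vrt; rewrite /par; case: pickP => [u|none].
    by rewrite (negPf vrt).
  by have [u] := depth_par v vrt; rewrite none.
have par_rt : par rt = rt by rewrite /par; case: pickP => //; rewrite eqxx.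
exists rt, par, depth; split.
- by split=> // v /parE/andP[].
- by move=> v /parE/andP[].
move=> x y axy.
have [//|no] : ((x != rt /\ par x = y) \/ (y != rt /\ par y = x)) \/
    ((x == rt) || (par x != y)) && ((y == rt) || (par y != x)).
  case: (eqVneq x rt) => [xr|xr]; case: (eqVneq y rt) => [yr|yr];
  case: (eqVneq (par x) y) => [px|px]; case: (eqVneq (par y) x) => [py|py];
  rewrite ?xr ?yr ?px ?py /=; auto.
pose e' : rel T := [rel u v | adj u v && ([set u; v] != [set x; y])].
have e'sym : symmetric e'.
  by move=> u v; rewrite /e' /= adj_sym setUC.
have csym : connect_sym e' by apply: sym_connect_sym.
have toroot v : connect e' v rt.
  elim: {v}(depth v).+1 {-2}v (ltnSn (depth v)) => // k IH v dv.
  have [->|vrt] := eqVneq v rt; first exact: connect0.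
  have /andP[apv dpv] := parE v vrt.
  apply: (@connect_trans _ _ (par v)); last by apply: IH; apply: leq_trans dpv _.
  apply: connect1; rewrite /e' /= adj_sym apv /=.
  apply/eqP=> E.
  have vxy : v \in [set x; y] by rewrite -E !inE eqxx.
  have pxy : par v \in [set x; y] by rewrite -E !inE eqxx orbT.
  have pv : par v != v by apply/eqP=> pvE; rewrite pvE ltnn in dpv.
  move: no vxy pxy; rewrite !inE => /andP[n1 n2] /orP[/eqP vE|/eqP vE] /orP[/eqP pE|/eqP pE].
  + by rewrite pE -vE eqxx in pv.
  + by rewrite -vE pE eqxx orbF (negPf vrt) in n1.
  + by rewrite -vE pE eqxx orbF (negPf vrt) in n2.
  + by rewrite pE -vE eqxx in pv.
have cxy : connect e' x y.
  by apply: connect_trans (toroot x) _; rewrite csym.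
case/connectP: cxy => p /shortenP[q eq uq _] lastq.
have qn0 : 1 < size q.
  case: q eq uq lastq => [|z [|z' q]] //=.
    by move=> _ _ E; move: axy; rewrite E adj_irr.
  by rewrite andbT => + _ zE; rewrite -zE /e' /= eqxx andbF.
have : size (x :: q) < 3; last by rewrite /= ltnS ltnNge qn0.
apply: acyc; apply/andP; split=> //=.
rewrite rcons_path -lastq adj_sym axy andbT.
by apply: sub_path eq => u v /andP[].
Qed.

Lemma degree_le_max (T : sgraph) (v : T) : degree v <= max_degree T.
Proof. exact: leq_bigmax. Qed.

(** * Cutting a rooted tree into pieces of comparable size *)

Section Cutting.
Variables (T : finType) (rt : T) (par : T -> T) (depth : T -> nat) (d t : nat).
Hypothesis rootT : rooted rt par depth.
Hypothesis children_le : forall v, #|children rt par v| <= d.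
Hypothesis d_gt0 : 0 < d.
Hypothesis t_gt0 : 0 < t.

(** Piece 0 is the root alone, and every other piece hangs by one edge from a piece of smaller
    number. The second summand in [cutting_number] pays for pieces with fewer than [t] vertices; in
    the construction these are rooted at children of the root. *)
Record cutting (A : {set T}) (s : nat) (pc : T -> nat) (rc : nat -> T) : Prop := Cutting {
  cutting_le : forall v, v \in A -> pc v <= s;
  cutting_root : forall v, v \in A -> (pc v == 0) = (v == rt);
  cutting_rc : forall j, 0 < j <= s ->
    [/\ rc j \in A, pc (rc j) = j, rc j != rt & pc (par (rc j)) < j];
  cutting_par : forall j v, 0 < j <= s -> v \in A -> pc v = j -> v != rc j ->
    pc (par v) = j;
  cutting_size : forall j, 0 < j <= s -> #|[set v in A | pc v == j]| <= d * t;
  cutting_number : s * t <= #|A| + t * #|A :&: children rt par rt| }.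

Lemma iter_root k : iter k par rt = rt.
Proof. by elim: k => //= k ->; rewrite (rooted_par_root rootT). Qed.

Lemma depth_iter k v : depth (iter k par v) <= depth v.
Proof.
elim: k => //= k IH; have [E|ne] := eqVneq (iter k par v) rt.
  by rewrite E (rooted_par_root rootT) -E.
exact: leq_trans (ltnW (rooted_depth rootT ne)) IH.
Qed.

Lemma fconnect_par v w : w != v -> fconnect par w v = fconnect par (par w) v.
Proof.
move=> wv; apply/idP/idP => [/iter_findex E|]; last first.
  by apply: connect_trans; apply: fconnect1.
move: E; case: (findex par w v) => [/= E|k]; first by rewrite E eqxx in wv.
by rewrite iterSr => <-; apply: fconnect_iter.
Qed.

(** Cut off the subtree of a deepest vertex with at least [t] descendants: its children have fewer
    than [t] each, so it has at most [1 + d(t-1)] vertices. If no vertex but possibly the root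
    qualifies, cut off the subtree of a child of the root. *)
Lemma cut_exists (A : {set T}) : rt \in A -> (forall v, v \in A -> par v \in A) ->
  exists s pc rc, cutting A s pc rc.
Proof.
have [N] := ubnP #|A|; elim: N A => // N IH A; rewrite ltnS => AN rtA Apar.
have [->|Ane] := eqVneq A [set rt].
  exists 0, (fun=> 0), (fun=> rt); split=> //.
  - by move=> v; rewrite inE => ->.
  - by case.
  - by move=> [|j] v.
pose desc v := [set w in A | fconnect par w v].
have descA v : desc v \subset A by apply/subsetP=> w; rewrite inE => /andP[].
suff [v [vA vrt dsize dbound]] : exists v, [/\ v \in A, v != rt, #|desc v| <= d * t
    & (t <= #|desc v|) || (par v == rt)].
  have pv : par v \notin desc v.
    rewrite inE Apar //=; apply/negP=> /iter_findex E.
    by have := depth_iter (findex par (par v) v) (par v); rewrite E leqNgt (rooted_depth rootT vrt).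
  have vd : v \in desc v by rewrite inE vA connect0.
  have rtd : rt \notin desc v.
    by rewrite inE rtA /=; apply/negP=> /iter_findex; rewrite iter_root => E; rewrite E eqxx in vrt.
  have cA' : #|A :\: desc v| + #|desc v| = #|A|.
    by rewrite -(cardsID (desc v) A) (setIidPr (descA v)) addnC.
  have d_ge1 : 0 < #|desc v| by apply/card_gt0P; exists v.
  have A'par w : w \in A :\: desc v -> par w \in A :\: desc v.
    rewrite !in_setD => /andP[wd wA]; rewrite Apar // andbT.
    apply: contra wd; rewrite !inE wA Apar //=.
    by apply: connect_trans; apply: fconnect1.
  have [| |//|s [pc [rc cut]]] := IH (A :\: desc v).
  - lia.
  - by rewrite in_setD rtd rtA.
  (* What is cut off first gets the largest number, so the parent of its root lies in a piece of
     smaller number. *)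
  pose pc' w := if w \in desc v then s.+1 else pc w.
  pose rc' j := if j == s.+1 then v else rc j.
  have pc'E w : w \in A :\: desc v -> pc' w = pc w.
    by rewrite in_setD /pc' => /andP[/negPf->].
  exists s.+1, pc', rc'; split.
  - move=> w wA; rewrite /pc'; case: ifPn => // wd.
    by rewrite leqW // (cutting_le cut) // in_setD wd.
  - move=> w wA; rewrite /pc'; case: ifPn => wd.
      by apply/esym/negP=> /eqP E; rewrite -E wd in rtd.
    by rewrite (cutting_root cut) // in_setD wd.
  - move=> j /andP[j0]; rewrite leq_eqVlt /rc' => /orP[/eqP->|js].
      rewrite eqxx /pc' vd (negPf pv); split=> //.
      by rewrite ltnS (cutting_le cut) // in_setD pv Apar.
    have [rA rpc rr rp] := cutting_rc cut (j := j) ltac:(by rewrite j0).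
    rewrite (ltn_eqF js) !pc'E ?A'par //; split=> //.
    by apply: (subsetP (subsetDl _ _)) rA.
  - move=> j w /andP[j0 js] wA; rewrite /rc' /pc'.
    case: ifPn => wd; case: (eqVneq j s.+1) => [jE|jE] wj wr.
    + have -> : par w \in desc v; last by rewrite jE.
      by move: wd; rewrite !inE Apar // wA fconnect_par.
    + by rewrite wj eqxx in jE.
    + have : pc w <= s by apply: (cutting_le cut); rewrite in_setD wd.
      by rewrite wj jE ltnn.
    + have wA' : w \in A :\: desc v by rewrite in_setD wd.
      have := A'par w wA'; rewrite in_setD => /andP[/negPf-> _].
      apply: (cutting_par cut (j := j)) => //.
      by rewrite j0 -ltnS ltn_neqAle jE js.
  - move=> j /andP[j0]; rewrite leq_eqVlt => /orP[/eqP->|js].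
      apply: leq_trans dsize; apply: subset_leq_card; apply/subsetP=> w; rewrite inE /pc'.
      case: ifPn => // wd /andP[wA /eqP E].
      have : pc w <= s by apply: (cutting_le cut); rewrite in_setD wd.
      by rewrite E ltnn.
    have := cutting_size cut (j := j); rewrite j0 -ltnS js => /(_ isT).
    apply: leq_trans; apply: subset_leq_card; apply/subsetP=> w; rewrite !inE /pc'.
    case: ifPn => [_ /andP[_ /eqP E]|wd /andP[wA ->]]; first by rewrite -E ltnn in js.
    by rewrite wA andbT; move: wd; rewrite inE wA andbT => ->.
  have := cutting_number cut.
  set c' := #|(A :\: desc v) :&: _|; set c := #|A :&: _| => bound.
  have c'c : c' <= c by apply/subset_leq_card/setSI/subsetDl.
  case/orP: dbound => [big|/eqP pvr].
    rewrite mulSn; move: (leq_mul (leqnn t) c'c); lia.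
  have : c'.+1 <= c.
    rewrite /c (cardsD1 v) !inE vA vrt pvr eqxx /= ltnS.
    apply/subset_leq_card/subsetP=> w; rewrite !inE => /andP[/andP[wd wA] ->].
    rewrite wA !andbT; apply: contraNneq wd => ->; by rewrite vA connect0.
  move=> /(leq_mul (leqnn t)); rewrite mulnS mulSn; lia.
have [/existsP[v0 pv0]|none] := boolP [exists v, [&& v \in A, v != rt & t <= #|desc v|]].
  have [v /and3P[vA vrt vt] vmax] := @arg_maxnP _ v0
    (fun v => [&& v \in A, v != rt & t <= #|desc v|]) depth pv0.
  exists v; split=> //; last by rewrite vt.
  have sub : desc v \subset v |: \bigcup_(c in A :&: children rt par v) desc c.
    apply/subsetP=> w; rewrite inE => /andP[wA /iter_findex E].
    move: E; elim: (findex par w v) {-2}w wA => [|k IHk] u uA /=.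
      by move=> ->; rewrite !inE eqxx.
    rewrite -iterS iterSr => E; have := IHk (par u) (Apar _ uA) E.
    case/setU1P=> [puv|/bigcupP[c cA]].
      have [->|uv] := eqVneq u v; first by rewrite !inE eqxx.
      apply/setU1P; right; apply/bigcupP; exists u; last by rewrite inE uA connect0.
      rewrite !inE uA puv eqxx andbT; apply: contraNneq vrt => urt.
      by rewrite -puv urt (rooted_par_root rootT).
    rewrite inE => /andP[_ puc]; apply/setU1P; right; apply/bigcupP; exists c => //.
    by rewrite inE uA; apply: connect_trans puc; apply: fconnect1.
  apply: leq_trans (subset_leq_card sub) _.
  apply: leq_trans (leq_card_setU _ _) _; rewrite cards1.
  have : #|\bigcup_(c in A :&: children rt par v) desc c| <= d * t.-1.
    apply: leq_trans (card_bigcup_leq _ _) _.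
    apply: (@leq_trans (\sum_(c in A :&: children rt par v) t.-1)).
      apply: leq_sum => c; rewrite !inE => /and3P[cA crt /eqP pc].
      rewrite -ltnS prednK // ltnNge; apply/negP=> tc.
      have /vmax : [&& c \in A, c != rt & t <= #|desc c|] by rewrite cA crt tc.
      by rewrite /geq /= leqNgt -pc (rooted_depth rootT crt).
    rewrite sum_nat_const leq_mul2r (leq_trans _ (children_le v)) ?orbT //.
    by apply/subset_leq_card/subsetIr.
  by case: (t) t_gt0 => // t' _; rewrite mulnS /= => /(leq_add d_gt0); apply.
have [v0 v0A v0r] : exists2 v, v \in A & v != rt.
  have : ~~ (A \subset [set rt]).
    by apply: contra Ane => sA; rewrite eqEsubset sA sub1set.
  by case/subsetPn=> v vA; rewrite inE => vr; exists v.
have pv0 : (v0 \in A) && (v0 != rt) by rewrite v0A.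
have [v /andP[vA vrt] vmin] := @arg_minnP _ v0
  (fun v => (v \in A) && (v != rt)) depth pv0.
have pvr : par v == rt.
  apply/negPn/negP=> pr; have := vmin (par v).
  by rewrite Apar // pr => /(_ isT); rewrite leqNgt (rooted_depth rootT vrt).
exists v; split=> //; last by rewrite pvr orbT.
move/existsPn: none => /(_ v); rewrite vA vrt /= -ltnNge => /ltnW le.
by apply: leq_trans le _; rewrite leq_pmull.
Qed.

End Cutting.

(** * Finite product probability spaces *)

Local Open Scope ring_scope.

Section ProductProbability.
Variables (R : realType) (I X : finType) (mu : I -> X -> R).
Hypothesis mu_ge0 : forall i x, 0 <= mu i x.
Hypothesis mu_sum : forall i, \sum_x mu i x = 1.

Definition weight (w : {ffun I -> X}) : R := \prod_i mu i (w i).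

Definition prob (E : {ffun I -> X} -> Prop) : R := \sum_(w | `[< E w >]) weight w.

Definition splice (A : {set I}) (w w' : {ffun I -> X}) : {ffun I -> X} :=
  [ffun i => if i \in A then w i else w' i].

Lemma weight_ge0 w : 0 <= weight w.
Proof. exact: prodr_ge0. Qed.

Lemma prob_ge0 E : 0 <= prob E.
Proof. by apply: sumr_ge0 => w _; apply: weight_ge0. Qed.

Lemma probE E : prob E = \sum_w weight w * `[< E w >]%:R.
Proof.
by rewrite /prob big_mkcond; apply: eq_bigr => w _; case: ifP; rewrite ?mulr1 ?mulr0.
Qed.

Lemma expect_prod (g : I -> X -> R) :
  \sum_w weight w * \prod_i g i (w i) = \prod_i \sum_x mu i x * g i x.
Proof.
rewrite bigA_distr_bigA /=; apply: eq_bigr => w _.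
by rewrite /weight -big_split.
Qed.

Lemma weight_sum : \sum_w weight w = 1.
Proof.
transitivity (\sum_w weight w * \prod_(i : I) 1).
  by apply: eq_bigr => w _; rewrite big1_eq mulr1.
rewrite (expect_prod (fun _ _ => 1)) big1 // => i _.
by under eq_bigr do rewrite mulr1; rewrite mu_sum.
Qed.

Lemma prob_le (E F : {ffun I -> X} -> Prop) : (forall w, E w -> F w) -> prob E <= prob F.
Proof.
move=> EF; rewrite !probE; apply: ler_sum => w _.
rewrite ler_wpM2l ?weight_ge0 // ler_nat.
by case: asboolP => // /EF/asboolT->.
Qed.

Lemma prob_not E : prob (fun w => ~ E w) = 1 - prob E.
Proof.
rewrite -weight_sum (bigID (fun w => `[< E w >])) /= -/(prob E) addrC addrK.
by apply: eq_bigl => w; rewrite asbool_neg.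
Qed.

Lemma prob_or E F : prob (fun w => E w \/ F w) <= prob E + prob F.
Proof.
rewrite !probE -big_split; apply: ler_sum => w _ /=.
rewrite -mulrDr ler_wpM2l ?weight_ge0 // -natrD ler_nat asbool_or.
by case: `[< E w >]; case: `[< F w >].
Qed.

Lemma prob_exists (J : finType) (P : pred J) (E : J -> {ffun I -> X} -> Prop) (c : R) :
  (forall j, P j -> prob (E j) <= c) ->
  prob (fun w => exists2 j, P j & E j w) <= #|P|%:R * c.
Proof.
move=> le; apply: (@le_trans _ _ (\sum_(j | P j) prob (E j))); last first.
  by rewrite mulr_natl -sumr_const; apply: ler_sum.
rewrite probE; under [leRHS]eq_bigr do rewrite probE.
rewrite exchange_big; apply: ler_sum => w _ /=.
rewrite -mulr_sumr ler_wpM2l ?weight_ge0 //.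
case: asboolP => [[j Pj Ew]|_]; last by rewrite sumr_ge0.
by rewrite (bigD1 j) ?Pj //= (asboolT Ew) lerDl sumr_ge0.
Qed.

Lemma splice_weight A w w' :
  weight (splice A w w') * weight (splice A w' w) = weight w * weight w'.
Proof.
rewrite /weight -!big_split; apply: eq_bigr => i _ /=; rewrite !ffunE.
by case: ifP => // _; rewrite mulrC.
Qed.

(** Swapping two independent samples off [A] preserves their joint weight. In later uses [A] is the
    set of revealed coordinates, and those off [A] are drawn afresh. *)
Lemma prob_resample A F :
  prob F = \sum_w weight w * prob (fun w' => F (splice A w w')).
Proof.
under [RHS]eq_bigr do rewrite probE mulr_sumr.
rewrite pair_big /=.
pose h (q : {ffun I -> X} * {ffun I -> X}) := (splice A q.1 q.2, splice A q.2 q.1).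
have hK : involutive h.
  by case=> w w'; rewrite /h /=; congr (_, _); apply/ffunP=> i; rewrite !ffunE;
    case: (i \in A).
rewrite (reindex_inj (inv_inj hK)) /=.
transitivity (\sum_w \sum_w' weight w * (weight w' * `[< F w >]%:R)).
  rewrite probE; apply: eq_bigr => w _.
  by rewrite -mulr_sumr -mulr_suml weight_sum mul1r.
rewrite pair_big /=; apply: eq_bigr => -[w w'] _ /=.
have -> : splice A (splice A w w') (splice A w' w) = w.
  by apply/ffunP=> i; rewrite !ffunE; case: (i \in A).
by rewrite !mulrA splice_weight.
Qed.

(** This replaces conditional probability: [E] need not be determined by the coordinates in [A], as
    long as the bound holds for every [w] in [E]. *)
Lemma prob_resample_ge A (E F : {ffun I -> X} -> Prop) (del : R) :
  (forall w, E w -> prob (fun w' => ~ F (splice A w w')) <= del) -> 0 <= del ->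
  prob E - del <= prob F.
Proof.
move=> le del0; rewrite (prob_resample A F).
have -> : prob E - del = \sum_w weight w * (`[< E w >]%:R - del).
  under eq_bigr do rewrite mulrBr.
  by rewrite sumrB -mulr_suml weight_sum mul1r probE.
apply: ler_sum => w _; rewrite ler_wpM2l ?weight_ge0 //.
case: asboolP => [Ew|_].
  by rewrite lerBlDr -lerBlDl -prob_not le.
by rewrite sub0r (le_trans _ (prob_ge0 _)) // oppr_le0.
Qed.

Lemma prob_resample_le A (F : {ffun I -> X} -> Prop) (del : R) :
  (forall w, prob (fun w' => F (splice A w w')) <= del) -> prob F <= del.
Proof.
move=> le; rewrite (prob_resample A F) -[del]mul1r -weight_sum mulr_suml.
by apply: ler_sum => w _; rewrite ler_wpM2l ?weight_ge0.
Qed.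

Lemma prob_avoid (L : {set I}) (S : I -> pred X) (theta : R) :
  (forall i, i \in L -> theta <= \sum_(x | S i x) mu i x) ->
  prob (fun w => forall i, i \in L -> ~~ S i (w i)) <= (1 - theta) ^+ #|L|.
Proof.
move=> le.
pose g i x : R := if i \in L then (~~ S i x)%:R else 1.
have -> : prob (fun w => forall i, i \in L -> ~~ S i (w i))
    = \sum_w weight w * \prod_i g i (w i).
  rewrite probE; apply: eq_bigr => w _; congr (_ * _).
  case: asboolP => [av|nav].
    by rewrite big1 // => i _; rewrite /g; case: ifP => // iL; rewrite av.
  have [i /andP[iL Si]|no] := pickP (fun i => (i \in L) && S i (w i)).
    by rewrite (bigD1 i) //= /g iL Si mul0r.
  by case: nav => i iL; have := no i; rewrite iL /= => ->.
rewrite expect_prod -prodr_const [leRHS]big_mkcond /=; apply: ler_prod => i _.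
rewrite /g; case: ifP => iL.
  have E : \sum_x mu i x * (~~ S i x)%:R = 1 - \sum_(x | S i x) mu i x.
    apply/esym/eqP; rewrite subr_eq -[X in X == _](mu_sum i) [X in _ + X]big_mkcond -big_split.
    apply/eqP/eq_bigr => x _ /=.
    by case: (S i x) => /=; rewrite ?mulr0 ?mulr1 ?add0r ?addr0.
  rewrite E lerB ?le // andbT -E; apply: sumr_ge0 => x _.
  by rewrite mulr_ge0.
by under eq_bigr do rewrite mulr1; rewrite mu_sum ler01 lexx.
Qed.

(** Markov's inequality for 2 to the power of the count, whose expectation is a product by
    independence. *)
Lemma prob_count (L : {set I}) (S : I -> pred X) (p : R) (b : nat) :
  (forall i, i \in L -> \sum_(x | S i x) mu i x <= p) ->
  prob (fun w => (b <= #|[set i in L | S i (w i)]|)%N) <= (1 + p) ^+ #|L| / 2 ^+ b.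
Proof.
move=> le; rewrite ler_pdivlMr ?exprn_gt0 //.
pose g i x : R := if (i \in L) && S i x then 2 else 1.
apply: (@le_trans _ _ (\sum_w weight w * \prod_i g i (w i))).
  rewrite probE mulr_suml; apply: ler_sum => w _.
  rewrite -mulrA ler_wpM2l ?weight_ge0 //.
  have -> : \prod_i g i (w i) = 2 ^+ #|[set i in L | S i (w i)]|.
    rewrite -prodr_const [RHS]big_mkcond /=; apply: eq_bigr => i _.
    by rewrite /g inE.
  case: asboolP => bl; last by rewrite mul0r exprn_ge0.
  by rewrite mul1r ler_eXn2l // ltr1n.
rewrite expect_prod -prodr_const [leRHS]big_mkcond /=; apply: ler_prod => i _.
apply/andP; split.
  by apply: sumr_ge0 => x _; rewrite mulr_ge0 // /g; case: ifP.
rewrite /g; case: ifP => iL /=; last by under eq_bigr do rewrite mulr1; rewrite mu_sum.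
have -> : \sum_x mu i x * (if S i x then 2 else 1) = 1 + \sum_(x | S i x) mu i x.
  rewrite -[X in X + _](mu_sum i) [X in _ + X]big_mkcond -big_split; apply: eq_bigr => x _ /=.
  by case: ifP => _; rewrite ?mulr1 ?addr0 // mulrDr mulr1.
by rewrite lerD2l le.
Qed.

End ProductProbability.

(** * Random coloured subgraphs *)

Local Open Scope ring_scope.

Section EdgeMeasure.
Variables (R : realType) (G : sgraph) (K : finType) (p : R).
Hypotheses (p_ge0 : 0 <= p) (p_le1 : p <= 1) (K_gt0 : (0 < #|K|)%N).

(** Coordinates are indexed by all vertex subsets, to match colourings that are defined on all of
    them; a non-edge is absent with probability 1 but still draws a colour. *)
Definition edge_mu (e : {set G}) (x : bool * K) : R :=
  (if e \in edges G then (if x.1 then p else 1 - p) else (~~ x.1)%:R) / #|K|%:R.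

Lemma edge_mu_ge0 e x : 0 <= edge_mu e x.
Proof.
rewrite divr_ge0 //; case: ifP => _ //; case: ifP => _ //.
by rewrite subr_ge0.
Qed.

Lemma sum_bool_pair (F : bool * K -> R) (P : pred (bool * K)) :
  \sum_(x | P x) F x =
  \sum_(c | P (true, c)) F (true, c) + \sum_(c | P (false, c)) F (false, c).
Proof.
pose g b c := if P (b, c) then F (b, c) else 0.
rewrite big_mkcond (eq_bigr (fun x => g x.1 x.2)); last by case.
rewrite -(pair_bigA _ g) /=.
by rewrite big_bool -!big_mkcond.
Qed.

Lemma edge_mu_sum e : \sum_x edge_mu e x = 1.
Proof.
have K0 : #|K|%:R != 0 :> R by rewrite pnatr_eq0 -lt0n.
rewrite sum_bool_pair /edge_mu /= !sumr_const; case: ifP => _.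
  by rewrite -mulrnDl -mulrDl addrC subrK mul1r -[LHS]mulr_natr mulVf.
by rewrite mul0r mul0rn add0r mul1r -[LHS]mulr_natr mulVf.
Qed.

Lemma edge_mu_event (e : {set G}) (D : {set K}) : e \in edges G ->
  \sum_(x | x.1 && (x.2 \in D)) edge_mu e x = p * #|D|%:R / #|K|%:R.
Proof.
move=> eG; rewrite sum_bool_pair /edge_mu eG /= big_pred0_eq addr0 sumr_const.
by rewrite -[LHS]mulr_natr mulrAC.
Qed.

Lemma edge_mu_present (e : {set G}) : e \in edges G ->
  \sum_(x | x.1) edge_mu e x = p.
Proof.
move=> eG; have := edge_mu_event [set: K] eG; rewrite cardsT mulfK; last first.
  by rewrite pnatr_eq0 -lt0n.
by move=> <-; apply: eq_bigl => x; rewrite inE andbT.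
Qed.

Lemma coloured_Gp_probE (Q : {set {set G}} -> {ffun {set G} -> K} -> bool) :
  coloured_Gp_prob p Q =
  prob edge_mu (fun w => Q [set e | (w e).1] [ffun e => (w e).2]).
Proof.
pose E := edges G.
pose h (q : {set {set G}} * {ffun {set G} -> K}) : {ffun {set G} -> bool * K} :=
  [ffun e => (e \in q.1, q.2 e)].
pose h' (w : {ffun {set G} -> bool * K}) := ([set e | (w e).1], [ffun e => (w e).2]).
have hK : cancel h h'.
  by case=> H c; congr pair; [apply/setP=> e; rewrite inE | apply/ffunP=> e]; rewrite !ffunE.
have h'K : cancel h' h.
  by move=> w; apply/ffunP=> e; rewrite !ffunE inE; case: (w e).
rewrite probE (reindex h) /=; last by exists h' => ? _.
pose g H c := weight edge_mu (h (H, c)) *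
  `[< Q [set e | (h (H, c) e).1] [ffun e => (h (H, c) e).2] >]%:R.
rewrite (eq_bigr (fun x => g x.1 x.2)); last by case.
rewrite -(pair_bigA _ g) {}/g /=.
rewrite /coloured_Gp_prob big_mkcond /=; apply: eq_bigr => H _.
have QE c : `[< Q [set e | (h (H, c) e).1] [ffun e => (h (H, c) e).2] >] = Q H c.
  by rewrite asboolb; have := hK (H, c); rewrite /h' => -[-> ->].
under eq_bigr do rewrite QE.
have wE c : weight edge_mu (h (H, c)) =
    (if H \subset E then p ^+ #|H| * (1 - p) ^+ #|E :\: H| else 0)
      / #|{ffun {set G} -> K}|%:R.
  rewrite /weight /edge_mu.
  under eq_bigr do rewrite ffunE /=.
  rewrite big_split /=; congr (_ * _); last first.
    by rewrite prodr_const card_ffun natrX exprVn.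
  case: ifPn => [sHE|/subsetPn[e eH eE]]; last first.
    by rewrite (bigD1 e) //= -/E (negPf eE) eH mul0r.
  rewrite -!prodr_const [X in _ = X * _]big_mkcond [X in _ = _ * X]big_mkcond -big_split /=.
  apply: eq_bigr => e _; rewrite in_setD -/E; case eH: (e \in H) => /=.
    by rewrite (subsetP sHE) // mulr1.
  by case: (e \in E); rewrite ?mul1r.
under eq_bigr do rewrite wE.
rewrite -mulr_sumr; case: ifP => _; last by rewrite !mul0r.
have -> : \sum_c (Q H c)%:R = #|[set c | Q H c]|%:R :> R.
  rewrite -natr_sum -sum1dep_card; congr (_%:R); rewrite [RHS]big_mkcond.
  by apply: eq_bigr => c _; case: (Q H c).
by rewrite [RHS]mulrAC [in LHS]mulrA.
Qed.

End EdgeMeasure.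

(** * Rainbow graphs inside a block *)

Local Open Scope ring_scope.

Section InnerEdges.
Variables (G : sgraph) (K : finType).
Implicit Types (A B W : {set G}) (L : {set {set G}}) (D : {set K}) (w : {ffun {set G} -> bool * K}).

Definition between A B : {set {set G}} :=
  [set e in edges G | [exists x in A, exists y in B, e == [set x; y]]].

Definition inner W : {set {set G}} := [set e in edges G | e \subset W].

Definition present w (L : {set {set G}}) : {set {set G}} := [set e in L | (w e).1].

Definition seen w (L : {set {set G}}) : {set K} := [set (w e).2 | e in present w L].

(** Only colours on the other inner edges are excluded; the colour may repeat between [A] and [B].
    Once the other inner edges are revealed, failure for a given pair therefore means that
    independent edges all miss a fixed set of colours. *)
Definition covering (a : nat) w W D : Prop := forall A B,
  A \subset W -> B \subset W -> [disjoint A & B] -> (a <= #|A|)%N -> (a <= #|B|)%N ->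
  exists2 e, e \in between A B &
    (w e).1 && ((w e).2 \in D :\: seen w (inner W :\: between A B)).

Record rainbow_rel w W D (er : rel G) : Prop := RainbowRel {
  rainbow_rel_in : forall x y, er x y ->
    [/\ [set x; y] \in inner W, (w [set x; y]).1 & (w [set x; y]).2 \in D];
  rainbow_rel_inj : forall x y x' y', er x y -> er x' y' ->
    (w [set x; y]).2 = (w [set x'; y']).2 -> [set x; y] = [set x'; y'] }.

Lemma between_inner A B W : A \subset W -> B \subset W -> between A B \subset inner W.
Proof.
move=> sA sB; apply/subsetP=> e; rewrite !inE => /andP[-> /existsP[x /andP[xA]]].
case/existsP=> y /andP[yB /eqP->] /=.
by rewrite subUset !sub1set (subsetP sA) ?(subsetP sB).
Qed.

Lemma seenP w L c : reflect (exists2 e, e \in L & (w e).1 /\ (w e).2 = c) (c \in seen w L).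
Proof.
apply: (iffP imsetP) => [[e]|[e eL [we <-]]].
  by rewrite inE => /andP[eL we] ->; exists e.
by exists e; rewrite ?inE ?eL.
Qed.

Lemma seen_eq w w' L : {in L, w =1 w'} -> seen w L = seen w' L.
Proof.
move=> E; apply/setP=> c; apply/seenP/seenP=> -[e eL H]; exists e => //.
  by rewrite -E.
by rewrite E.
Qed.

Lemma rainbow_rel_eq w w' W D er : {in inner W, w =1 w'} ->
  rainbow_rel w W D er -> rainbow_rel w' W D er.
Proof.
move=> E [rin rinj]; split=> [x y|x y x' y'] exy.
  by have [i1 i2 i3] := rin _ _ exy; rewrite -E.
move=> exy'; have [i1 _ _] := rin _ _ exy; have [j1 _ _] := rin _ _ exy'.
by rewrite -!E //; apply: rinj.
Qed.

(* One representative edge is kept for each colour of D seen inside W.  If some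
   colour is seen only on edges between A and B, its representative lies there. *)
Lemma covering_rainbow_joined a w W D : covering a w W D ->
  exists2 er : rel G, rainbow_rel w W D er & joined er a W.
Proof.
move=> cov.
pose rep c := [pick e | (e \in inner W) && ((w e).1 && ((w e).2 == c))].
have repP c e : rep c = Some e -> [/\ e \in inner W, (w e).1 & (w e).2 = c].
  by rewrite /rep; case: pickP => // e' /and3P[? ? /eqP ?] [<-].
exists [rel x y | [exists c in D, rep c == Some [set x; y]]].
  split=> [x y|x y x' y'] /= /existsP[c /andP[cD /eqP rc]].
    by have [i1 i2 i3] := repP _ _ rc; rewrite i1 i2 i3.
  case/existsP=> c' /andP[c'D /eqP rc'] E.
  have [_ _ ic] := repP _ _ rc; have [_ _ ic'] := repP _ _ rc'.
  have cc' : c = c' by rewrite -ic -ic'.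
  by move: rc'; rewrite -cc' rc => -[].
move=> A B sA sB dAB aA aB.
have [e eAB /andP[we /setDP[cD cns]]] := cov A B sA sB dAB aA aB.
have eW : e \in inner W by apply: (subsetP (between_inner sA sB)).
have [e' rce] : exists e', rep (w e).2 = Some e'.
  by rewrite /rep; case: pickP => [e' _|/(_ e)]; [exists e' | rewrite eW we eqxx].
have [i1 i2 i3] := repP _ _ rce.
have : e' \in between A B.
  apply/negPn/negP=> ne'; case/negP: cns; apply/seenP; exists e' => //.
  by rewrite in_setD ne'.
rewrite inE => /andP[_ /existsP[x /andP[xA /existsP[y /andP[yB /eqP eE]]]]].
exists x, y; split=> //=; apply/existsP; exists (w e).2.
by rewrite cD rce eE eqxx.
Qed.

End InnerEdges.

Section InnerProbability.
Variables (R : realType) (G : sgraph) (K : finType) (p : R).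
Hypotheses (p_ge0 : 0 <= p) (p_le1 : p <= 1) (K_gt0 : (0 < #|K|)%N).
Local Notation Pr := (prob (@edge_mu R G K p)).
Let mu_ge0 := edge_mu_ge0 (G := G) (K := K) p_ge0 p_le1.
Let mu_sum := @edge_mu_sum R G K p K_gt0.

(** For a fixed pair, reveal everything off [between A B]. Fewer than [b] colours have then been
    seen inside [W], so each edge between succeeds with probability at least [theta]. A union bound
    over pairs of subsets of [W] follows. *)
Lemma prob_not_covering (W : {set G}) (D : {set K}) (a b : nat) (theta c : R) :
  0 <= c ->
  (forall D' : {set K}, (#|D| < #|D'| + b)%N -> theta <= p * #|D'|%:R / #|K|%:R) ->
  (forall A B : {set G}, [disjoint A & B] -> (a <= #|A|)%N -> (a <= #|B|)%N ->
    (1 - theta) ^+ #|between A B| <= c) ->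
  Pr (fun w => (#|present w (inner W)| < b)%N /\ ~ covering a w W D)
    <= (2 ^ (#|W| + #|W|))%:R * c.
Proof.
move=> c_ge0 Hth Hc.
pose P (q : {set G} * {set G}) := [&& q.1 \subset W, q.2 \subset W, [disjoint q.1 & q.2],
  (a <= #|q.1|)%N & (a <= #|q.2|)%N].
pose fails (q : {set G} * {set G}) (w : {ffun {set G} -> bool * K}) :=
  (#|present w (inner W)| < b)%N /\ forall e, e \in between q.1 q.2 ->
    ~~ ((w e).1 && ((w e).2 \in D :\: seen w (inner W :\: between q.1 q.2))).
apply: (@le_trans _ _ (Pr (fun w => exists2 q, P q & fails q w))).
  apply: prob_le => // w [few ncov]; apply/not_exists2P => no.
  apply: ncov => A B sA sB dAB aA aB; apply/exists2P/not_existsP => nex.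
  have [|nf] := no (A, B); first by rewrite /P sA sB dAB aA aB.
  apply: nf; split=> // e eAB; apply/negP=> H; exact: (nex e).
apply: (@le_trans _ _ (#|P|%:R * c)); last first.
  rewrite ler_wpM2r // ler_nat expnD -!card_powerset -cardsX.
  apply/subset_leq_card/subsetP=> -[A B] /and5P[/= sA sB _ _ _].
  by rewrite !inE /= sA sB.
apply: prob_exists => // -[A B] /and5P[/= sA sB dAB aA aB].
have sABW := between_inner sA sB.
apply: (@prob_resample_le _ _ _ _ mu_ge0 mu_sum (~: between A B)) => w.
set Q := seen w (inner W :\: between A B).
have QE w' : seen (splice (~: between A B) w w') (inner W :\: between A B) = Q.
  by apply: seen_eq => e /setDP[_ ne]; rewrite ffunE inE ne.
(* If [b] colours have already been seen, fewer than [b] present edges is impossible and the event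
   is empty. *)
have [bQ|Qb] := leqP b #|Q|.
  apply: le_trans c_ge0; rewrite -(addrN (1 : R)) -(@weight_sum _ _ _ _ mu_sum).
  rewrite /prob big_pred0 ?subrr // => w'; apply/negP=> /asboolP[few _].
  have : (#|Q| <= #|present (splice (~: between A B) w w') (inner W)|)%N.
    rewrite -(QE w'); apply: leq_trans (leq_imset_card _ _) _.
    by apply/subset_leq_card/subsetP=> e; rewrite !inE => /andP[/andP[_ ->] ->].
  by rewrite leqNgt (leq_trans few).
apply: le_trans (Hc A B dAB aA aB).
apply: le_trans (prob_avoid mu_ge0 mu_sum (L := between A B)
  (S := fun _ x => x.1 && (x.2 \in D :\: Q)) (theta := theta) _); last first.
  move=> e eAB; rewrite edge_mu_event; last by move: eAB; rewrite inE => /andP[].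
  apply: Hth; rewrite -(cardsID Q D) addnC ltn_add2l.
  by rewrite (leq_ltn_trans _ Qb) // subset_leq_card // subsetIr.
apply: prob_le => // w' [_ avoid] e eAB; have := avoid e eAB.
by rewrite QE ffunE inE eAB.
Qed.

End InnerProbability.

(** * Partial embeddings *)

Local Open Scope nat_scope.

Section Process.
Variables (G : sgraph) (K T : finType) (rt : T) (par : T -> T) (depth : T -> nat).
Variables (d t a s : nat) (pc : T -> nat) (rc : nat -> T) (blk : G -> nat) (Bad : {set G}).
Hypothesis rootT : rooted rt par depth.
Hypothesis children_le : forall v, #|children rt par v| <= d.
Hypothesis cutT : cutting rt par d t [set: T] s pc rc.
Hypothesis a_gt0 : 0 < a.
Implicit Types (w : {ffun {set G} -> bool * K}) (f phi : T -> G) (Z : {set G}).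

Definition block j : {set G} := [set x | blk x == j].
Definition below j : {set {set G}} := [set e : {set G} | e \subset [set x | blk x < j]].
Definition piece j : {set T} := [set v | pc v == j].
Definition tedge f v : {set G} := [set f (par v); f v].

(** Although [f] is total, only its values on pieces numbered below [j] are meaningful. *)
Record placed (j : nat) w f : Prop := Placed {
  placed_blk : forall v, pc v < j -> blk (f v) = pc v /\ f v \notin Bad;
  placed_inj : forall v v', pc v < j -> pc v' < j -> f v = f v' -> v = v';
  placed_present : forall v, pc v < j -> v != rt -> (w (tedge f v)).1;
  placed_rainbow : forall v v', pc v < j -> pc v' < j -> v != rt -> v' != rt ->
    (w (tedge f v)).2 = (w (tedge f v')).2 -> v = v' }.

Definition free j w f : {set K} :=
  ~: [set (w (tedge f v)).2 | v in [set v | (pc v < j) && (v != rt)]].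

(** Distinctness is required at every attachment vertex embedded so far, not just at the next one,
    because a later piece may hang from any earlier piece. *)
Definition options j N w (F : nat -> T -> G) : Prop :=
  (forall k, k < N -> placed j w (F k)) /\
  (forall i k k', 0 < i <= s -> pc (par (rc i)) < j -> k < N -> k' < N ->
     F k (par (rc i)) = F k' (par (rc i)) -> k = k').

Lemma pc_le v : pc v <= s.
Proof. exact: (cutting_le cutT). Qed.

Lemma pc_gt0 v : v != rt -> 0 < pc v.
Proof. by rewrite lt0n (cutting_root cutT). Qed.

Lemma pc_par v : v != rt -> pc (par v) <= pc v.
Proof.
move=> vrt; have vs : 0 < pc v <= s by rewrite pc_gt0 ?pc_le.
have [E|ne] := eqVneq v (rc (pc v)); last by rewrite (cutting_par cutT vs _ _ ne).
by rewrite {1}E; have [_ _ _ /ltnW] := cutting_rc cutT vs.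
Qed.

Lemma tedge_inj (P : pred T) f v v' : {in P &, injective f} ->
  P v -> P v' -> P (par v) -> P (par v') -> v != rt -> v' != rt ->
  tedge f v = tedge f v' -> v = v'.
Proof.
move=> inj Pv Pv' Ppv Ppv' vrt v'rt E.
have : f v \in tedge f v' by rewrite -E !inE eqxx orbT.
rewrite !inE => /orP[/eqP/(inj _ _ Pv Ppv') vE|/eqP/(inj _ _ Pv Pv')//].
have : f v' \in tedge f v by rewrite E !inE eqxx orbT.
rewrite !inE => /orP[/eqP/(inj _ _ Pv' Ppv) v'E|/eqP/(inj _ _ Pv' Pv)//].
have := rooted_depth rootT vrt; have := rooted_depth rootT v'rt.
by rewrite -vE -v'E => /ltn_trans/[apply]; rewrite ltnn.
Qed.

Lemma tedge_below j f v : (forall v, pc v < j -> blk (f v) = pc v) ->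
  pc v < j -> v != rt -> tedge f v \in below j.
Proof.
move=> fb vj vrt; rewrite inE subUset !sub1set !inE.
have pj := leq_ltn_trans (pc_par vrt) vj.
by rewrite !fb ?vj ?pj.
Qed.

Lemma placed_below j w f v : placed j w f -> pc v < j -> v != rt -> tedge f v \in below j.
Proof. by move=> pl; apply: tedge_below => u /(placed_blk pl)[]. Qed.

Lemma placed_eq j w w' f :
  (forall v, pc v < j -> v != rt -> w (tedge f v) = w' (tedge f v)) ->
  placed j w f -> placed j w' f.
Proof.
move=> E [p1 p2 p3 p4]; split=> //.
  by move=> v vj vr; rewrite -E ?p3.
by move=> v v' vj v'j vr v'r; rewrite -!E //; apply: p4.
Qed.

Lemma free_eq j w w' f : {in below j, w =1 w'} -> placed j w f -> free j w' f = free j w f.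
Proof.
move=> E pl; congr (~: _); apply: eq_in_imset => v; rewrite inE => /andP[vj vr].
by rewrite E // (placed_below pl).
Qed.

Lemma card_free j w f : #|K| <= #|free j w f| + #|T|.
Proof.
rewrite -(cardsC (free j w f)) leq_add2l setCK.
by apply: leq_trans (leq_imset_card _ _) (max_card _).
Qed.

Lemma free_old j w f v : pc v < j -> v != rt -> (w (tedge f v)).2 \notin free j w f.
Proof. by move=> vj vr; rewrite inE negbK; apply: imset_f; rewrite inE vj. Qed.

Definition extend j f phi v := if pc v == j then phi v else f v.

(** Edges of the new piece use distinct colours that are free for [f]. The link uses a free colour
    seen on no edge inside the block, so it clashes neither with the old edges nor with the new
    piece. *)
Lemma extend_placed j w f phi Z er : 0 < j <= s -> placed j w f ->
  rainbow_rel w (block j) (free j w f) er -> Bad \subset Z ->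
  {in piece j &, injective phi} ->
  (forall v, v \in piece j -> phi v \in block j :\: Z) ->
  (forall v, v \in piece j -> v != rc j -> er (phi (par v)) (phi v)) ->
  (w [set f (par (rc j)); phi (rc j)]).1 ->
  (w [set f (par (rc j)); phi (rc j)]).2 \in free j w f :\: seen w (inner (block j)) ->
  placed j.+1 w (extend j f phi).
Proof.
move=> js pl rr BZ phi_inj phi_blk phi_er lpres lcol.
have [_ rcj rcrt rcp] := cutting_rc cutT js.
have exN v : pc v < j -> extend j f phi v = f v.
  by move=> vj; rewrite /extend ltn_eqF.
have exP v : pc v = j -> extend j f phi v = phi v.
  by move=> vj; rewrite /extend vj eqxx.
have parj v : pc v = j -> v != rc j -> pc (par v) = j.
  by move=> vj; apply: (cutting_par cutT js).
have teN v : pc v < j -> v != rt -> tedge (extend j f phi) v = tedge f v.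
  by move=> vj vr; rewrite /tedge !exN // (leq_ltn_trans (pc_par vr)).
have teL : tedge (extend j f phi) (rc j) = [set f (par (rc j)); phi (rc j)].
  by rewrite /tedge (exP (rc j)) ?(exN (par (rc j))).
have teP v : pc v = j -> v != rc j -> tedge (extend j f phi) v = tedge phi v.
  by move=> vj vr; rewrite /tedge !exP // parj.
have inP v : pc v = j -> v \in piece j by rewrite inE => /eqP.
have erP v : pc v = j -> v != rc j -> [/\ tedge phi v \in inner (block j),
    (w (tedge phi v)).1 & (w (tedge phi v)).2 \in free j w f].
  by move=> vj vr; apply: (rainbow_rel_in rr); apply: phi_er => //; apply: inP.
have seenPh v : pc v = j -> v != rc j -> (w (tedge phi v)).2 \in seen w (inner (block j)).
  by move=> vj vr; have [? ? ?] := erP v vj vr; apply/seenP; exists (tedge phi v).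
have blkP v : pc v = j -> blk (phi v) = j /\ phi v \notin Bad.
  move=> /inP/phi_blk/setDP[]; rewrite inE => /eqP-> nZ; split=> //.
  by apply: contra nZ; apply: (subsetP BZ).
have blkE v : pc v < j.+1 -> blk (extend j f phi v) = pc v /\ extend j f phi v \notin Bad.
  rewrite ltnS leq_eqVlt => /orP[/eqP vj|vj]; first by rewrite exP // vj; apply: blkP.
  by rewrite exN //; apply: (placed_blk pl).
have injE v v' : pc v < j.+1 -> pc v' < j.+1 ->
    extend j f phi v = extend j f phi v' -> v = v'.
  move=> vj v'j E; have pE : pc v = pc v'.
    by have [<- _] := blkE v vj; have [<- _] := blkE v' v'j; rewrite E.
  move: vj; rewrite ltnS leq_eqVlt => /orP[/eqP vj|vj].
    by move: E; rewrite !exP -?pE //; apply: phi_inj; apply: inP; rewrite -?pE.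
  by move: E; rewrite !exN -?pE //; apply: (placed_inj pl); rewrite -?pE.
split=> //.
  move=> v; rewrite ltnS leq_eqVlt => /orP[/eqP vj|vj] vr; last first.
    by rewrite teN // (placed_present pl).
  by have [->|ne] := eqVneq v (rc j); [rewrite teL | rewrite teP //; case: (erP v vj ne)].
have cases v : pc v < j.+1 -> [\/ pc v < j, v = rc j | pc v = j /\ v != rc j].
  rewrite ltnS leq_eqVlt => /orP[/eqP vj|vj]; last by constructor 1.
  by have [->|ne] := eqVneq v (rc j); [constructor 2 | constructor 3].
have /setDP[lfree lseen] := lcol.
move=> v v' /cases + /cases + vr v'r.
case=> [vj|->|[vj vne]]; case=> [v'j|->|[v'j v'ne]] //.
- by rewrite !teN //; apply: (placed_rainbow pl).
- by rewrite teN // teL => E; move: lfree; rewrite -E (negPf (free_old _ _ vj vr)).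
- rewrite teN // teP // => E; have [_ _] := erP v' v'j v'ne.
  by rewrite -E (negPf (free_old _ _ vj vr)).
- by rewrite teL teN // => E; move: lfree; rewrite E (negPf (free_old _ _ v'j v'r)).
- by rewrite teL teP // => E; move: lseen; rewrite E seenPh.
- rewrite (teN v') // teP // => E; have [_ _] := erP v vj vne.
  by rewrite E (negPf (free_old _ _ v'j v'r)).
- by rewrite teL teP // => E; move: lseen; rewrite -E seenPh.
rewrite !teP // => /(rainbow_rel_inj rr (phi_er _ (inP _ vj) vne) (phi_er _ (inP _ v'j) v'ne)).
apply: (@tedge_inj (mem (piece j)) phi v v') => //; apply: inP => //; exact: parj.
Qed.

(** [Z] holds the forbidden vertices. It is removed before passing to the expanding core, which
    loses at most [a] more vertices and still has the room asked for by [tree_embedding]. *)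
Lemma core_exists j er Z : 0 < j <= s -> joined er a (block j) ->
  #|piece j| + (2 * d + 5) * a + #|Z| <= #|block j| ->
  exists Y : {set G}, [/\ Y \subset block j :\: Z, #|block j :\: Y| <= a + #|Z|
  & forall y, y \in Y -> exists phi : T -> G, [/\ phi (rc j) = y,
      {in piece j &, injective phi}, forall v, v \in piece j -> phi v \in block j :\: Z
    & forall v, v \in piece j -> v != rc j -> er (phi (par v)) (phi v)]].
Proof.
move=> js jW big.
have [_ rcj rcrt rcp] := cutting_rc cutT js.
have cZ : #|block j| <= #|block j :\: Z| + #|Z|.
  by rewrite -(cardsID Z (block j)) addnC leq_add2l subset_leq_card ?subsetIr.
have jWZ := joined_sub (subsetDl (block j) Z) jW.
have bigWZ : (2 * d + 5) * a <= #|block j :\: Z| by lia.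
have [Y [YW Ya sm lg]] := expanding_core a_gt0 jWZ bigWZ.
have cY : #|block j :\: Z :\: Y| + #|Y| = #|block j :\: Z|.
  by rewrite -(cardsID Y (block j :\: Z)) (setIidPr YW) addnC.
exists Y; split=> //.
  have -> : block j :\: Y = (block j :\: Z :\: Y) :|: (block j :&: Z :\: Y).
    by apply/setP=> x; rewrite !inE; case: (x \in Y); case: (x \in Z); case: (blk x == j).
  apply: leq_trans (leq_card_setU _ _) _; rewrite leq_add // subset_leq_card //.
  by apply: subset_trans (subsetDl _ _) (subsetIr _ _).
move=> y yY.
have emb := @tree_embedding _ er T (piece j) (rc j) par depth d a Y a_gt0.
have [| | | |phi [p1 p2 p3 p4]] := emb _ _ _ sm lg _ y yY.
- by rewrite inE rcj.
- move=> v; rewrite inE => /eqP vj vr.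
  have vrt : v != rt by rewrite -(cutting_root cutT (in_setT v)) vj -lt0n; case/andP: js.
  by rewrite inE (cutting_par cutT js) // eqxx (rooted_depth rootT).
- move=> v; apply: leq_trans (children_le v); apply/subset_leq_card/subsetP=> u.
  rewrite !inE => /andP[/andP[_ /eqP uj] ->]; rewrite andbT.
  by rewrite -(cutting_root cutT (in_setT u)) uj -lt0n; case/andP: js.
- by move: cY Ya cZ big bigWZ; clear; nia.
exists phi; split=> // v vj.
exact: (subsetP YW) (p3 v vj).
Qed.

End Process.

(** * Extending partial embeddings *)

Local Open Scope ring_scope.

Section Step.
Variables (R : realType) (G : sgraph) (K T : finType) (p theta : R).
Variables (rt : T) (par : T -> T) (depth : T -> nat).
Variables (d t a s b : nat) (pc : T -> nat) (rc : nat -> T) (blk : G -> nat) (Bad : {set G}).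
Hypotheses (p_ge0 : 0 <= p) (p_le1 : p <= 1) (K_gt0 : (0 < #|K|)%N).
Hypothesis rootT : rooted rt par depth.
Hypothesis children_le : forall v, (#|children rt par v| <= d)%N.
Hypothesis cutT : cutting rt par d t [set: T] s pc rc.
Hypotheses (a_gt0 : (0 < a)%N) (d_gt0 : (0 < d)%N).
Hypothesis theta_le : forall D : {set K}, (#|K| <= #|D| + #|T| + b)%N ->
  theta <= p * #|D|%:R / #|K|%:R.
Hypotheses (theta_ge0 : 0 <= theta) (theta_le1 : theta <= 1).
Hypothesis theta_half : (1 - theta) ^+ a <= 2^-1.
Hypothesis degree_block : forall x j, (0 < j <= s)%N -> blk x != j -> x \notin Bad ->
  (#|block blk j| <= 3 * #|[set y in block blk j | adj x y]|)%N.
Hypothesis block_room : forall j, (0 < j <= s)%N ->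
  (#|piece pc j| + (2 * d + 8) * a <= #|block blk j|)%N.

Local Notation Pr := (prob (@edge_mu R G K p)).
Local Notation "'W_ j" := (block blk j) (at level 8, j at level 2, format "''W_' j").
Local Notation placed := (placed rt par pc blk Bad).
Local Notation free := (@free G K T rt par pc).
Local Notation options := (@options G K T rt par s pc rc blk Bad).
Let mu_ge0 := edge_mu_ge0 (G := G) (K := K) p_ge0 p_le1.
Let mu_sum := @edge_mu_sum R G K p K_gt0.
Implicit Types (w : {ffun {set G} -> bool * K}) (F : nat -> T -> G).

Definition link_source j F k : G := F k (par (rc j)).

(* The edges from the links of the groups g, g+1, ... to block j stay hidden. *)
Definition exposed j N B F g : {set {set G}} :=
  ~: [set e | [exists k : 'I_(N * B), exists y in 'W_j,
        (g * B <= k)%N && (e == [set link_source j F k; y])]].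

(** Groups [0] to [g-1], of [B] options each, have yielded one extension each. All edges of these
    extensions are exposed, so that they persist when the rest is redrawn, and each agrees on the
    earlier pieces with an option of a treated group. *)
Definition group_state j N B F g w : Prop :=
  [/\ options j (N * B) w F,
      forall k, (k < N * B)%N -> covering a w 'W_j (free j w (F k)),
      (#|present w (inner 'W_j)| < b)%N
    & exists F', [/\ options j.+1 g w F',
        forall i v, (i < g)%N -> (pc v < j.+1)%N -> v != rt ->
          tedge par (F' i) v \in exposed j N B F g
      & forall i, (i < g)%N -> exists2 k, (k < g * B)%N &
          forall v, (pc v < j)%N -> F' i v = F k v]].

Section Group.
Variables (j N B : nat) (F : nat -> T -> G).
Hypothesis js : (0 < j <= s)%N.
Hypothesis few : (#|Bad| + N * s.+1 <= a)%N.
Local Notation expo := (exposed j N B F).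
Local Notation x k := (link_source j F k).

(** Each of the [B] options of group [g] has at least [a] possible links into its core. These links
    are distinct hidden edges, so all fail with probability at most [(1 - theta)^(B * a)], which is
    at most [2^-B]. *)
Lemma group_step g w : (g < N)%N -> group_state j N B F g w ->
  Pr (fun w' => ~ group_state j N B F g.+1 (splice (expo g) w w')) <= 2^-1 ^+ B.
Proof.
move=> gN [[Fpl Fdist] cov few_present [F' [[F'pl F'dist] F'exp F'ext]]].
have [_ rcj rcrt rcp] := cutting_rc cutT js.
have xblk k : (k < N * B)%N -> (blk (x k) < j)%N /\ x k \notin Bad.
  by move=> /Fpl/placed_blk/(_ _ rcp)[E ?]; rewrite /link_source E.
have gBN i : (i < B)%N -> (g * B + i < N * B)%N.
  by move=> iB; rewrite (@leq_trans (g.+1 * B)) // ?leq_mul2r ?gN ?orbT // mulSn addnC ltn_add2r.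
have blkW y : y \in 'W_j -> blk y = j by rewrite inE => /eqP.
have hidden e g' : e \notin expo g' -> exists k y,
    [/\ (g' * B <= k < N * B)%N, y \in 'W_j & e = [set x k; y]].
  rewrite !inE negbK => /existsP[k /existsP[y /and3P[yW gk /eqP->]]].
  by exists k, y; rewrite gk ltn_ord yW.
have below_exp g' : below blk j \subset expo g'.
  apply/subsetP=> e eb; apply/negPn/negP=> /hidden[k [y [_ yW eE]]].
  move: eb; rewrite inE eE subUset !sub1set !inE (blkW y yW) ltnn.
  by rewrite andbF.
have inner_exp g' : inner 'W_j \subset expo g'.
  apply/subsetP=> e; rewrite inE => /andP[_ eW].
  apply/negPn/negP=> /hidden[k [y [/andP[_ kN] yW eE]]].
  have [xj _] := xblk k kN; move: eW; rewrite eE subUset !sub1set inE => /andP[/eqP E _].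
  by rewrite E ltnn in xj.
have exp_mono : expo g \subset expo g.+1.
  apply/subsetP=> e eg; apply/negPn/negP=> /hidden[k [y [/andP[gk kN] yW eE]]].
  move: eg; rewrite !inE => /existsPn/(_ (Ordinal kN))/existsPn/(_ y).
  by rewrite yW eE eqxx andbT /= (leq_trans _ gk) // leq_mul2r leqnSn orbT.
have link_exp k y : (k < g.+1 * B)%N -> y \in 'W_j -> [set x k; y] \in expo g.+1.
  move=> kg yW; apply/negPn/negP=> /hidden[k' [y' [/andP[gk' k'N] y'W eE]]].
  have kk' : (k < k')%N := leq_trans kg gk'.
  have kN := ltn_trans kk' k'N.
  have : x k \in [set x k'; y'] by rewrite -eE !inE eqxx.
  rewrite !inE => /orP[/eqP/(Fdist _ _ _ js rcp kN k'N) E|/eqP E].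
    by rewrite E ltnn in kk'.
  by have [xj _] := xblk k kN; rewrite E (blkW _ y'W) ltnn in xj.
have link_hidden (i : 'I_B) y : y \in 'W_j -> [set x (g * B + i); y] \notin expo g.
  move=> yW; rewrite !inE negbK; apply/existsP; exists (Ordinal (gBN i (ltn_ord i))).
  by apply/existsP; exists y; rewrite yW leq_addr eqxx.
(* Besides [Bad], the new piece avoids the images of all attachment vertices under the extensions
   found so far, which keeps these images distinct. *)
pose Z := Bad :|: [set F' q.1 (par (rc q.2)) | q : 'I_g * 'I_s.+1].
have cZ : (#|Z| <= a)%N.
  apply: leq_trans few; apply: leq_trans (leq_card_setU _ _) _.
  rewrite leq_add2l; apply: leq_trans (leq_imset_card _ _) _.
  by rewrite card_prod !card_ord leq_mul2r ltnW ?orbT.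
have /choice[q qP] : forall i : 'I_B, exists q : rel G * {set G},
    rainbow_rel w 'W_j (free j w (F (g * B + i))) q.1 /\
    [/\ q.2 \subset 'W_j :\: Z, (#|'W_j :\: q.2| <= a + #|Z|)%N
    & forall y, y \in q.2 -> exists phi : T -> G, [/\ phi (rc j) = y,
      {in piece pc j &, injective phi}, forall v, v \in piece pc j -> phi v \in 'W_j :\: Z
    & forall v, v \in piece pc j -> v != rc j -> q.1 (phi (par v)) (phi v)]].
  move=> i; have [er rr jn] := covering_rainbow_joined (cov _ (gBN i (ltn_ord i))).
  have room : (#|piece pc j| + (2 * d + 5) * a + #|Z| <= #|'W_j|)%N.
    by apply: leq_trans (block_room js); move: cZ; clear; lia.
  by have [Y ?] := core_exists rootT children_le cutT a_gt0 js jn room; exists (er, Y).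
pose PP := [set r : 'I_B * G | (r.2 \in (q r.1).2) && adj (x (g * B + r.1)) r.2].
pose im (r : 'I_B * G) := [set x (g * B + r.1); r.2].
pose L := im @: PP.
have qW i y : y \in (q i).2 -> y \in 'W_j.
  by move=> yq; have [_ [/subsetP/(_ y yq)/setDP[]]] := qP i.
have cL : (B * a <= #|L|)%N.
  rewrite card_in_imset; last first.
    move=> [i y] [i' y']; rewrite !inE /im /= => /andP[yq _] /andP[y'q _] E.
    have xE : x (g * B + i) = x (g * B + i').
      have : x (g * B + i) \in [set x (g * B + i'); y'] by rewrite -E !inE eqxx.
      rewrite !inE => /orP[/eqP//|/eqP E'].
      have [xj _] := xblk _ (gBN i (ltn_ord i)).
      by rewrite E' (blkW _ (qW _ _ y'q)) ltnn in xj.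
    have iE := Fdist _ _ _ js rcp (gBN _ (ltn_ord i)) (gBN _ (ltn_ord i')) xE.
    have : y \in [set x (g * B + i'); y'] by rewrite -E !inE eqxx orbT.
    rewrite !inE => /orP[/eqP E'|/eqP->].
      have [xj _] := xblk _ (gBN i' (ltn_ord i')).
      by rewrite -E' (blkW _ (qW _ _ yq)) ltnn in xj.
    by congr pair; apply: val_inj => /=; apply/eqP; rewrite -(eqn_add2l (g * B)) iE.
  have -> : #|PP| = (\sum_(i < B) #|[set y in (q i).2 | adj (x (g * B + i)) y]|)%N.
    rewrite -sum1_card.
    rewrite (eq_bigl (fun r : 'I_B * G => true && ((r.2 \in (q r.1).2) && adj (x (g * B + r.1)) r.2))); last by move=> r; rewrite inE.
    rewrite -(pair_big_dep xpredT (fun i y => (y \in (q i).2) && adj (x (g * B + i)) y) (fun _ _ => 1%N)) /=.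
    by apply: eq_bigr => i _; rewrite sum1dep_card.
  rewrite -[X in (X * a)%N]card_ord -sum_nat_const; apply: leq_sum => i _.
  have [xj xB] := xblk _ (gBN i (ltn_ord i)).
  have xne : blk (x (g * B + i)) != j by rewrite ltn_eqF.
  have := degree_block js xne xB; have [_ [_ qa _]] := qP i.
  have := block_room js.
  have : (#|[set y in 'W_j | adj (x (g * B + i)) y]|
      <= #|[set y in (q i).2 | adj (x (g * B + i)) y]| + #|'W_j :\: (q i).2|)%N.
    apply: leq_trans (leq_card_setU _ _); apply/subset_leq_card/subsetP=> y.
    by rewrite !inE => /andP[-> ->]; case: (y \in _).
  (* The link source has at least [(2d+8)a/3] neighbours in the block, hence at least [10a/3], and
     the core misses at most [2a] vertices; at least [a] remain. *)
  by move: qa cZ d_gt0; clear; nia.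
pose col (i : 'I_B) := free j w (F (g * B + i)) :\: seen w (inner 'W_j).
pose S (e : {set G}) (z : bool * K) :=
  z.1 && [exists r in PP, (im r == e) && (z.2 \in col r.1)].
apply: (@le_trans _ _ ((1 - theta) ^+ #|L|)); last first.
  have t0 : 0 <= 1 - theta by rewrite subr_ge0.
  apply: (@le_trans _ _ ((1 - theta) ^+ (B * a))).
    by rewrite ler_wiXn2l // gerBl.
  by rewrite mulnC exprM; apply: lerXn2r => //; rewrite nnegrE ?exprn_ge0 ?invr_ge0.
apply: (@le_trans _ _ (Pr (fun w' => forall e, e \in L -> ~~ S e (w' e)))); last first.
  apply: prob_avoid => // e /imsetP[r rPP ->].
  have := rPP; rewrite inE => /andP[rq radj].
  have eG : im r \in edges G.
    rewrite inE; apply/existsP; exists (x (g * B + r.1)); apply/existsP; exists r.2.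
    by rewrite radj eqxx.
  apply: (@le_trans _ _ (p * #|col r.1|%:R / #|K|%:R)).
    apply: theta_le; have := card_free rt par pc j w (F (g * B + r.1)).
    have : (#|free j w (F (g * B + r.1))| <= #|col r.1| + b)%N.
      rewrite -(cardsID (seen w (inner 'W_j))) addnC leq_add2l.
      apply: leq_trans (subset_leq_card (subsetIr _ _)) _.
      exact: leq_trans (leq_imset_card _ _) (ltnW few_present).
    by clear; lia.
  rewrite -(edge_mu_event p _ eG) big_mkcond [leRHS]big_mkcond /=.
  apply: ler_sum => -[c z] _ /=; rewrite /S /=; case: c => //=.
  case: ifP => zc; last by case: ifP => _ //; apply: mu_ge0.
  rewrite (_ : [exists r0 in PP, _]) //; apply/existsP; exists r.
  by rewrite rPP eqxx zc.
apply: prob_le => // w'; set w1 := splice (expo g) w w' => nst e eL; apply/negP=> Se.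
apply: nst; move: Se => /andP[we /existsP[r /and3P[rPP /eqP rE rcol]]].
have w1E e' : e' \in expo g -> w e' = w1 e' by move=> eg; rewrite ffunE eg.
have Ebelow : {in below blk j, w =1 w1} by move=> e' /(subsetP (below_exp g)); apply: w1E.
have Einner : {in inner 'W_j, w =1 w1} by move=> e' /(subsetP (inner_exp g)); apply: w1E.
have Fpl1 k : (k < N * B)%N -> placed j w1 (F k).
  move=> kN; apply: placed_eq (Fpl k kN) => v vj vr.
  by apply: Ebelow; apply: (placed_below cutT) (Fpl k kN) vj vr.
have freeE k : (k < N * B)%N -> free j w1 (F k) = free j w (F k).
  by move=> kN; apply: (free_eq cutT) (Fpl k kN).
have seenE (L' : {set {set G}}) : L' \subset inner 'W_j -> seen w1 L' = seen w L'.
  by move=> sL; apply/esym/seen_eq => e' /(subsetP sL); apply: Einner.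
have presE : present w1 (inner 'W_j) = present w (inner 'W_j).
  apply/setP=> e'; rewrite [LHS]inE [RHS]inE; apply: andb_id2l => eW.
  by rewrite -Einner.
split.
- by split.
- move=> k kN A A' sA sA' dA aA aA'; have [e' e'A H] := cov k kN A A' sA sA' dA aA aA'.
  exists e' => //; rewrite -Einner ?(subsetP (between_inner sA sA')) // freeE //.
  by rewrite seenE // subsetDl.
- by rewrite presE.
case: r rPP rE rcol => i y; rewrite inE /im /= => /andP[yq _] eE rcol.
set k := (g * B + i)%N in eE.
have kN : (k < N * B)%N := gBN i (ltn_ord i).
have yW := qW i y yq.
have [rr [_ _ /(_ y yq)[phi [phr phinj phW pher]]]] := qP i.
have lE : w1 [set F k (par (rc j)); phi (rc j)] = w' e.
  by rewrite phr -/(x k) ffunE (negPf (link_hidden i y yW)) eE.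
have pl' : placed j.+1 w1 (extend pc j (F k) phi).
  apply: (extend_placed rootT cutT (Z := Z) (er := (q i).1)) => //.
  - exact: Fpl1.
  - by rewrite freeE //; apply: rainbow_rel_eq Einner rr.
  - exact: subsetUl.
  - by rewrite lE.
  - by rewrite lE freeE // seenE.
have F'pl1 i' : (i' < g)%N -> placed j.+1 w1 (F' i').
  move=> ig; apply: placed_eq (F'pl i' ig) => v vj vr; apply: w1E.
  exact: F'exp.
exists (fun i' => if i' == g then extend pc j (F k) phi else F' i'); split.
- split=> [i'|].
    by rewrite ltnS leq_eqVlt; case: eqP => //= _; apply: F'pl1.
  (* An attachment vertex in piece [j] is kept apart by [Z]. An earlier one is kept apart because
     the two extensions come from options of different groups. *)
  have new_old i1 i2 : (0 < i1 <= s)%N -> (pc (par (rc i1)) < j.+1)%N -> (i2 < g)%N ->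
      extend pc j (F k) phi (par (rc i1)) <> F' i2 (par (rc i1)).
    move=> i1s pj i2g; rewrite /extend; case: eqP => [pE|/eqP pne] E.
      have /phW/setDP[_ /negP] : par (rc i1) \in piece pc j by rewrite inE pE.
      apply; rewrite E inE; apply/orP; right; apply/imsetP.
      have i1s' : (i1 < s.+1)%N by case/andP: i1s.
      by exists (Ordinal i2g, Ordinal i1s').
    have pj' : (pc (par (rc i1)) < j)%N by rewrite ltn_neqAle pne.
    have [k2 k2g k2E] := F'ext i2 i2g.
    have k2k : (k2 < k)%N := leq_trans k2g (leq_addr _ _).
    have := Fdist i1 k k2 i1s pj' kN (ltn_trans k2k kN).
    by rewrite E k2E // => /(_ erefl) kE; rewrite kE ltnn in k2k.
  move=> i1 i2 i3 i1s pj; rewrite !ltnS.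
  case: eqP => [->|/eqP ne2] le2; case: eqP => [->|/eqP ne3] le3 //.
  - by move/new_old; case=> //; rewrite ltn_neqAle ne3.
  - by move/esym/new_old; case=> //; rewrite ltn_neqAle ne2.
  - by apply: (F'dist i1) => //; rewrite ltn_neqAle ?ne2 ?ne3.
- move=> i' v ig vj vr; case: eqP => [_|/eqP ne]; last first.
    by apply: (subsetP exp_mono); apply: F'exp => //; rewrite ltn_neqAle ne.
  move: vj; rewrite ltnS leq_eqVlt => /orP[/eqP vj|vj]; last first.
    apply: (subsetP (below_exp _)).
    have -> : tedge par (extend pc j (F k) phi) v = tedge par (F k) v.
      by rewrite /tedge /extend !ltn_eqF // (leq_ltn_trans (pc_par cutT vr)).
    exact: (placed_below cutT) (Fpl k kN) vj vr.
  have [vE|vne] := eqVneq v (rc j).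
    rewrite vE /tedge /extend rcj eqxx (ltn_eqF rcp) phr.
    by apply: link_exp => //; rewrite mulSn addnC ltn_add2l.
  apply: (subsetP (inner_exp _)); rewrite /tedge /extend vj.
  rewrite (cutting_par cutT js (in_setT v) vj vne) eqxx.
  have vP : v \in piece pc j by rewrite inE vj.
  by have [? _ _] := rainbow_rel_in rr (pher v vP vne).
move=> i' ig; case: eqP => [_|/eqP ne].
  by exists k; [rewrite mulSn addnC ltn_add2l | move=> v vj; rewrite /extend ltn_eqF].
have [|k2 k2g k2E] := F'ext i'; first by rewrite ltn_neqAle ne.
by exists k2 => //; apply: leq_trans k2g _; rewrite leq_mul2r leqnSn orbT.
Qed.

Lemma below_exposed g : below blk j \subset expo g.
Proof.
apply/subsetP=> e eb; rewrite !inE; apply/existsPn=> k; apply/existsPn=> y.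
apply/negP=> /and3P[yW _ /eqP eE]; move: eb yW.
by rewrite inE eE subUset !sub1set !inE => /andP[_ yj] /eqP yE; rewrite yE ltnn in yj.
Qed.

(** [w0] fixes the coordinates on which the options in [F] live; they are exposed at every step, so
    redrawing the hidden ones does not disturb them. *)
Lemma group_steps g w0 : (g <= N)%N ->
  Pr (fun w => group_state j N B F 0 (splice (below blk j) w0 w)) - g%:R * 2^-1 ^+ B
    <= Pr (fun w => group_state j N B F g (splice (below blk j) w0 w)).
Proof.
elim: g => [|g IH] gN; first by rewrite mul0r subr0.
rewrite -natr1 mulrDl mul1r opprD addrA.
apply: le_trans (lerB (IH (ltnW gN)) (lexx _)) _.
apply: (prob_resample_ge mu_ge0 mu_sum (A := expo g)); last by rewrite exprn_ge0 ?invr_ge0.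
move=> w st; apply: le_trans (group_step gN st); apply: prob_le => // w'.
have -> // : splice (below blk j) w0 (splice (expo g) w w')
           = splice (expo g) (splice (below blk j) w0 w) w'.
apply/ffunP=> e; rewrite !ffunE; case eb: (e \in below blk j) => //.
by rewrite (subsetP (below_exposed g)).
Qed.

Hypothesis few_inner : (1 + p) ^+ #|inner 'W_j| / 2 ^+ b <= 2^-1 ^+ a.
Hypothesis many_between : forall A A' : {set G}, [disjoint A & A'] ->
  (a <= #|A|)%N -> (a <= #|A'|)%N ->
  (1 - theta) ^+ #|between A A'| <= 2^-1 ^+ (3 * #|'W_j|).

Lemma inner_step w0 : options j (N * B) w0 F ->
  Pr (fun w => ~ group_state j N B F 0 (splice (below blk j) w0 w))
    <= (N * B).+1%:R * 2^-1 ^+ a.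
Proof.
move=> [Fpl Fdist]; pose D (k : 'I_(N * B)) := free j w0 (F k).
have innerE w : {in inner 'W_j, splice (below blk j) w0 w =1 w}.
  move=> e; rewrite inE => /andP[eG eW]; rewrite ffunE; case: ifP => //.
  rewrite inE => eb; move: eG; rewrite inE => /existsP[x /existsP[y /andP[_ /eqP eE]]].
  have xe : x \in e by rewrite eE !inE eqxx.
  move: (subsetP eb x xe) (subsetP eW x xe); rewrite !inE => xj /eqP xE.
  by rewrite xE ltnn in xj.
have belowE w : {in below blk j, w0 =1 splice (below blk j) w0 w}.
  by move=> e eb; rewrite ffunE eb.
apply: (@le_trans _ _ (Pr (fun w => (b <= #|[set e in inner 'W_j | (w e).1]|)%N \/
    exists2 k : 'I_(N * B), true & (#|present w (inner 'W_j)| < b)%N /\ ~ covering a w 'W_j (D k)))).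
  apply: prob_le => // w nst; apply: contrapT => /not_orP[/negP nb nex]; apply: nst.
  rewrite -ltnNge in nb.
  have Fpl1 k : (k < N * B)%N -> placed j (splice (below blk j) w0 w) (F k).
    move=> kN; apply: placed_eq (Fpl k kN) => v vj vr; apply: belowE.
    exact: (placed_below cutT) (Fpl k kN) vj vr.
  split.
  - by split.
  - move=> k kN; have -> : free j (splice (below blk j) w0 w) (F k) = D (Ordinal kN).
      by apply: (free_eq cutT) (Fpl k kN).
    have : covering a w 'W_j (D (Ordinal kN)).
      by apply: contrapT => nc; apply: nex; exists (Ordinal kN).
    move=> cov A A' sA sA' dA aA aA'; have [e eA H] := cov A A' sA sA' dA aA aA'.
    exists e => //; rewrite innerE ?(subsetP (between_inner sA sA')) //.
    rewrite (_ : seen _ _ = seen w (inner 'W_j :\: between A A')) //.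
    by apply: seen_eq => e' /setDP[/innerE].
  - rewrite (_ : present _ _ = [set e in inner 'W_j | (w e).1]) //.
    by apply/setP=> e; rewrite [LHS]inE [RHS]inE; apply: andb_id2l => /innerE->.
  - by exists F; split.
apply: le_trans (prob_or mu_ge0 _ _) _; rewrite -natr1 mulrDl mul1r addrC.
apply: lerD; last first.
  apply: le_trans few_inner; apply: (prob_count mu_ge0 mu_sum (S := fun _ z => z.1)) => e; rewrite inE => /andP[eG _].
  by rewrite edge_mu_present.
apply: (@le_trans _ _ (#|(fun _ : 'I_(N * B) => true)|%:R * 2^-1 ^+ a)); last first.
  by rewrite card_ord.
apply: prob_exists => // k _.
have h0 m : 0 <= (2^-1 : R) ^+ m by rewrite exprn_ge0 ?invr_ge0.
(* There are at most [4^|W_j|] pairs of subsets and each fails with probability at most [8^-|W_j|];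
   what remains is [2^-|W_j|], at most [2^-a]. *)
apply: (@le_trans _ _ ((2 ^ (#|'W_j| + #|'W_j|))%:R * 2^-1 ^+ (3 * #|'W_j|))).
  apply: (@prob_not_covering _ _ _ _ p_ge0 p_le1 K_gt0 _ _ _ _ theta) => //.
  move=> D' lt; apply: theta_le; have := card_free rt par pc j w0 (F k).
  by move: lt; rewrite /D; clear; lia.
have -> : (3 * #|'W_j| = (#|'W_j| + #|'W_j|) + #|'W_j|)%N by lia.
rewrite exprD mulrA natrX exprVn divff ?mul1r; last by rewrite expf_neq0 // pnatr_eq0.
rewrite ler_wiXn2l ?invr_ge0 ?invf_le1 ?ler1n //.
by have := block_room js; move: d_gt0; clear; nia.
Qed.

End Group.

Lemma stage_step j N B : (0 < j <= s)%N -> (#|Bad| + N * s.+1 <= a)%N ->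
  (1 + p) ^+ #|inner 'W_j| / 2 ^+ b <= 2^-1 ^+ a ->
  (forall A A' : {set G}, [disjoint A & A'] -> (a <= #|A|)%N -> (a <= #|A'|)%N ->
    (1 - theta) ^+ #|between A A'| <= 2^-1 ^+ (3 * #|'W_j|)) ->
  Pr (fun w => exists F, options j (N * B) w F)
      - ((N * B).+1%:R * 2^-1 ^+ a + N%:R * 2^-1 ^+ B)
    <= Pr (fun w => exists F, options j.+1 N w F).
Proof.
move=> js few H1 H2.
have h0 m : 0 <= (2^-1 : R) ^+ m by rewrite exprn_ge0 ?invr_ge0.
apply: (prob_resample_ge mu_ge0 mu_sum (A := below blk j)); last first.
  by rewrite addr_ge0 // mulr_ge0.
move=> w0 [F optF].
apply: (@le_trans _ _ (Pr (fun w => ~ group_state j N B F N (splice (below blk j) w0 w)))).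
  by apply: prob_le => // w nex st; apply: nex; case: st => _ _ _ [F' [? _ _]]; exists F'.
rewrite prob_not // lerBlDr -lerBlDl.
apply: le_trans (group_steps B F js few w0 (leqnn N)).
rewrite opprD addrA lerD2r.
by have := inner_step js few H1 H2 optF; rewrite prob_not // lerBlDr -lerBlDl.
Qed.

(* N options are obtained from N groups of N + m: a group fails with probability at
   most 2^-(N + m), hence some group fails with probability at most 2^-m. *)
Fixpoint option_count (m i : nat) : nat :=
  if i is i'.+1 then option_count m i' * (option_count m i' + m) else 1.

Lemma option_count_gt0 m i : (0 < option_count m i)%N.
Proof. by elim: i => //= i IH; rewrite muln_gt0 IH ltn_addr. Qed.

Lemma option_count_mono m i i' : (i <= i')%N -> (option_count m i <= option_count m i')%N.
Proof.
elim: i' => [|i' IH]; first by rewrite leqn0 => /eqP->.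
rewrite leq_eqVlt => /orP[/eqP->//|/IH le] /=.
by apply: leq_trans le _; rewrite leq_pmulr // ltn_addr // option_count_gt0.
Qed.

Lemma options_initial N w : (0 < N)%N -> (N <= #|block blk 0 :\: Bad|)%N ->
  exists F, options 1 N w F.
Proof.
move=> N0 le; have /card_gt0P[x0 _] := leq_trans N0 le.
pose z k := nth x0 (enum (block blk 0 :\: Bad)) k.
have zin k : (k < N)%N -> z k \in block blk 0 :\: Bad.
  by move=> kN; rewrite -mem_enum mem_nth // -cardE (leq_trans kN).
have root0 v : (pc v < 1)%N -> v = rt.
  by rewrite ltnS leqn0 (cutting_root cutT) ?inE // => /eqP.
exists (fun k _ => z k); split=> [k kN|i k k' _ _ kN k'N /eqP].
  split.
  - move=> v v0; have := zin k kN; rewrite in_setD inE => /andP[-> /eqP->].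
    by move: v0; rewrite ltnS leqn0 => /eqP->.
  - by move=> v v' /root0-> /root0->.
  - by move=> v /root0->; rewrite eqxx.
  - by move=> v v' /root0-> /root0->.
by rewrite nth_uniq ?enum_uniq -?cardE ?(leq_trans kN) ?(leq_trans k'N) // => /eqP.
Qed.

Section Stages.
Variable m : nat.
Hypothesis initial : (option_count m s <= #|block blk 0 :\: Bad|)%N.
Hypothesis few : (#|Bad| + option_count m s * s.+1 <= a)%N.
Hypothesis few_inner : forall j, (0 < j <= s)%N ->
  (1 + p) ^+ #|inner 'W_j| / 2 ^+ b <= 2^-1 ^+ a.
Hypothesis many_between : forall j, (0 < j <= s)%N ->
  forall A A' : {set G}, [disjoint A & A'] ->
  (a <= #|A|)%N -> (a <= #|A'|)%N ->
  (1 - theta) ^+ #|between A A'| <= 2^-1 ^+ (3 * #|'W_j|).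

Lemma stages j : (j <= s)%N ->
  1 - j%:R * ((option_count m s).+1%:R * 2^-1 ^+ a + 2^-1 ^+ m)
    <= Pr (fun w => exists F, options j.+1 (option_count m (s - j)) w F).
Proof.
elim: j => [|j IH] js.
  rewrite mul0r subr0 subn0 -(weight_sum mu_sum) probE; apply: ler_sum => w _.
  by rewrite asboolT ?mulr1 //; apply: options_initial; rewrite ?option_count_gt0.
have js' : (0 < j.+1 <= s)%N by [].
set N := option_count m (s - j.+1).
have few' : (#|Bad| + N * s.+1 <= a)%N.
  by apply: leq_trans few; rewrite leq_add2l leq_mul2r option_count_mono ?leq_subr ?orbT.
have := stage_step (N := N) (N + m) js' few' (few_inner js') (many_between js').
apply: le_trans; rewrite -natr1 mulrDl mul1r opprD addrA.
have h0 k : 0 <= (2^-1 : R) ^+ k by rewrite exprn_ge0 ?invr_ge0.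
have NE : (N * (N + m) = option_count m (s - j))%N by rewrite -(subnSK js).
rewrite NE; apply: lerB; first exact: IH (ltnW js).
apply: lerD.
  by rewrite ler_wpM2r // ler_nat ltnS option_count_mono // leq_subr.
rewrite exprD mulrA -[leRHS]mul1r ler_wpM2r // exprVn ler_pdivrMr ?exprn_gt0 //.
by rewrite mul1r -natrX ler_nat ltnW // ltn_expl.
Qed.

End Stages.

End Step.

Lemma placed_rainbow_copy (G T : sgraph) (K : finType) (rt : T) (par : T -> T)
    (depth : T -> nat) (d t s : nat) (pc : T -> nat) (rc : nat -> T) (blk : G -> nat)
    (Bad : {set G}) (w : {ffun {set G} -> bool * K}) (f : T -> G) :
  cutting rt par d t [set: T] s pc rc ->
  (forall x y : T, adj x y -> (x != rt /\ par x = y) \/ (y != rt /\ par y = x)) ->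
  placed rt par pc blk Bad s.+1 w f ->
  has_rainbow_copy T [set e | (w e).1] [ffun e => (w e).2].
Proof.
move=> cutT adjP pl.
have pcs v : (pc v < s.+1)%N by rewrite ltnS (pc_le cutT).
apply/existsP; exists [ffun v => f v].
have ceP e : e \in copy_edges [ffun v => f v] -> exists2 v, v != rt & e = tedge par f v.
  case/imsetP=> e0; rewrite inE => /existsP[x /existsP[y /andP[axy /eqP->]]] ->.
  have im u v : [set [ffun v => f v] z | z in [set u; v]] = [set f u; f v].
    by rewrite imsetU1 imset_set1 !ffunE.
  by rewrite im; case: (adjP x y axy) => -[vr <-]; [exists x | exists y];
    rewrite // /tedge setUC.
apply/and3P; split.
- by apply/injectiveP=> u v; rewrite !ffunE; apply: (placed_inj pl).
- by apply/subsetP=> e /ceP[v vr ->]; rewrite inE (placed_present pl).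
apply/forallP=> e1; apply/implyP=> /ceP[v1 v1r ->].
apply/forallP=> e2; apply/implyP=> /ceP[v2 v2r ->].
apply/implyP; rewrite !ffunE => /eqP E; apply/eqP.
by rewrite (placed_rainbow pl (pcs v1) (pcs v2) v1r v2r E).
Qed.

(** * Blocks and powers *)

Local Open Scope nat_scope.

Lemma subset_of_card (V : finType) (U : {set V}) k : k <= #|U| ->
  exists2 A : {set V}, A \subset U & #|A| = k.
Proof.
move=> le; exists [set x in take k (enum U)].
  by apply/subsetP=> x; rewrite inE => /mem_take; rewrite mem_enum.
by rewrite cardsE (card_uniqP _) ?take_uniq ?enum_uniq // size_take_min -cardE; apply/minn_idPl.
Qed.

Lemma blocks_exist (V : finType) (s : nat) (sz : nat -> nat) :
  \sum_(j < s) sz j <= #|V| ->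
  exists2 blk : V -> nat, forall j, j < s -> #|[set x | blk x == j]| = sz j
  & #|[set x | blk x == s]| + \sum_(j < s) sz j = #|V|.
Proof.
elim: s => [_|s IH].
  exists (fun=> 0) => //; rewrite big_ord0 addn0 -cardsT.
  by apply: eq_card => x; rewrite !inE.
rewrite big_ord_recr /= => le.
have [|blk bE rest] := IH; first by apply: leq_trans le; apply: leq_addr.
have [|A sA cA] := @subset_of_card _ [set x | blk x == s] (sz s).
  by move: le; rewrite -rest addnC leq_add2r.
have Ablk x : x \in A -> blk x = s by move/(subsetP sA); rewrite inE => /eqP.
(* Labels above [s] are unconstrained, so any vertex already labelled [s.+1] is moved away before
   that label is given to the leftover. *)
pose blk' x := if (blk x == s) && (x \notin A) then s.+1 else if blk x == s.+1 then s.+2 else blk x.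
exists blk'.
  move=> j; rewrite ltnS leq_eqVlt => /orP[/eqP->|js].
    rewrite -cA; apply: eq_card => x; rewrite inE /blk'.
    case xA: (x \in A); first by rewrite andbF (Ablk x xA) (ltn_eqF (ltnSn s)) eqxx.
    rewrite andbT; case: (eqVneq (blk x) s) => [_|ne]; first by rewrite gtn_eqF.
    by case: (eqVneq (blk x) s.+1) => [_|_]; [rewrite gtn_eqF // ltnW | apply/negbTE].
  rewrite -(bE j js); apply: eq_card => x; rewrite !inE /blk'.
  case: (eqVneq (blk x) s) => [->|ne] /=.
    by case: (x \in A) => /=; rewrite ?(ltn_eqF (ltnSn s)) // !gtn_eqF // ltnW.
  by case: (eqVneq (blk x) s.+1) => [->|//]; rewrite !gtn_eqF //; lia.
rewrite -rest -(cardsID A [set x | blk x == s]) (setIidPr sA) cA.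
suff -> : #|[set x | blk' x == s.+1]| = #|[set x | blk x == s] :\: A|.
  by rewrite addnA addnC addnA.
apply: eq_card => x; rewrite !inE /blk'; case: (eqVneq (blk x) s) => [->|ne].
  by case: (x \in A) => /=; rewrite ?eqxx // ?(ltn_eqF (ltnSn s)) // ltn_eqF.
by rewrite andbF; case: (eqVneq (blk x) s.+1) => [_|/negbTE->//]; rewrite gtn_eqF.
Qed.

Lemma edges_adj (G : sgraph) (x y : G) : [set x; y] \in edges G -> adj x y.
Proof.
rewrite inE => /existsP[u /existsP[v /andP[auv /eqP E]]].
have uv : u != v by apply: contraTneq auv => ->; rewrite adj_irr.
have : u \in [set x; y] by rewrite E !inE eqxx.
have : v \in [set x; y] by rewrite E !inE eqxx orbT.
rewrite !inE => /orP[]/eqP vE /orP[]/eqP uE; subst u v => //; rewrite ?eqxx // in uv.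
by rewrite adj_sym.
Qed.

Definition low_degree (G : sgraph) (W : {set G}) : {set G} :=
  [set x | (x \notin W) && (3 * #|[set y in W | adj x y]| < #|W|)].

(** Otherwise pseudorandomness would apply to [low_degree W] and [W], while summing degrees gives
    fewer than a third of all pairs. *)
Lemma low_degree_few (G : sgraph) (W : {set G}) : 0 < #|G| -> pseudorandom G ->
  #|low_degree W| * #|W| < 250 * #|G|.
Proof.
move=> G0 psr; rewrite ltnNge; apply/negP=> big.
have dXW : [disjoint low_degree W & W].
  by apply/pred0P=> x /=; rewrite !inE; case: (x \in W); rewrite ?andbF.
have := psr _ _ dXW big.
have : edges_between (low_degree W) W <= \sum_(x in low_degree W) #|[set y in W | adj x y]|.
  apply: (@leq_trans #|\bigcup_(x in low_degree W) [set [set x; y] | y in [set y in W | adj x y]]|).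
    apply/subset_leq_card/subsetP=> e; rewrite inE => /andP[eG].
    case/existsP=> x /andP[xX /existsP[y /andP[yW /eqP eE]]].
    apply/bigcupP; exists x => //; apply/imsetP; exists y => //.
    by rewrite inE yW edges_adj // -eE.
  apply: leq_trans (card_bigcup_leq _ _) _; apply: leq_sum => x _.
  exact: leq_imset_card.
have : 3 * \sum_(x in low_degree W) #|[set y in W | adj x y]| + #|low_degree W|
    <= #|low_degree W| * #|W|.
  rewrite big_distrr /= -[X in _ + X]sum1_card -big_split /= -sum_nat_const.
  by apply: leq_sum => x; rewrite inE addn1 => /andP[].
case: (posnP #|low_degree W|) => [E|pos]; last by lia.
by rewrite E mul0n in big; lia.
Qed.

Lemma inner_card (G : sgraph) (W : {set G}) : #|inner W| <= #|W| * #|W|.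
Proof.
rewrite -cardsX; apply: leq_trans (leq_imset_card (fun q : G * G => [set q.1; q.2]) _).
apply/subset_leq_card/subsetP=> e; rewrite inE => /andP[].
rewrite inE => /existsP[x /existsP[y /andP[_ /eqP->]]].
rewrite subUset !sub1set => /andP[xW yW]; apply/imsetP; exists (x, y) => //.
by rewrite inE /= xW.
Qed.

Local Open Scope ring_scope.

Lemma bernoulli (R : realType) (x : R) n : -1 <= x -> 1 + n%:R * x <= (1 + x) ^+ n.
Proof.
move=> x1; elim: n => [|n IH]; first by rewrite mul0r addr0 expr0.
have x0 : 0 <= 1 + x by rewrite -(opprK 1) addrC subr_ge0.
rewrite exprS; apply: le_trans (ler_wpM2l x0 IH).
rewrite -natr1; have := mulr_ge0 (ler0n R n) (sqr_ge0 x).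
by move: (n%:R : R) => u; rewrite expr2; lra.
Qed.

(** By Bernoulli [(1+x)^n] is at least 2, and [(1-x)^n (1+x)^n] is at most 1. *)
Lemma expr_le_half (R : realType) (x : R) n :
  0 <= x -> x <= 1 -> 1 <= n%:R * x -> (1 - x) ^+ n <= 2^-1.
Proof.
move=> x0 x1 nx; have y0 : 0 <= (1 - x) ^+ n by rewrite exprn_ge0 ?subr_ge0.
rewrite -[leRHS]mul1r ler_pdivlMr //.
apply: (@le_trans _ _ ((1 - x) ^+ n * (1 + x) ^+ n)).
  rewrite ler_wpM2l //; apply: le_trans (bernoulli n _); last first.
    by apply: le_trans x0; rewrite lerN10.
  by rewrite (_ : 2 = 1 + 1) // lerD2l.
rewrite -exprMn -subr_sqr expr1n exprn_ile1 ?gerBl ?sqr_ge0 //.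
by rewrite subr_ge0 exprn_ile1.
Qed.

Lemma expr_le_two (R : realType) (x : R) n :
  0 <= x -> x <= 1 -> n%:R * x <= 2^-1 -> (1 + x) ^+ n <= 2.
Proof.
move=> x0 x1 nx.
have z : 0 < (1 - x) ^+ n.
  apply: lt_le_trans (bernoulli n _); last by rewrite lerN2.
  rewrite mulrN subr_gt0; apply: le_lt_trans nx _.
  by rewrite invf_lt1 // ltr1n.
rewrite -(ler_pM2r z); apply: (@le_trans _ _ 1).
  rewrite -exprMn mulrC -subr_sqr expr1n exprn_ile1 ?gerBl ?sqr_ge0 //.
  by rewrite subr_ge0 exprn_ile1.
have : 2^-1 <= (1 - x) ^+ n.
  apply: le_trans (bernoulli n _); last by rewrite lerN2.
  rewrite mulrN lerBrDl -lerBrDr; apply: le_trans nx _.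
  by lra.
by move: ((1 - x) ^+ n) => u; lra.
Qed.

(** * Choice of the parameters *)

Local Open Scope nat_scope.

Lemma divn_half m n : 0 < m -> m <= n -> n <= 2 * m * (n %/ m).
Proof.
move=> m0 mn; have q0 : 0 < n %/ m by rewrite divn_gt0.
by have := ltn_ceil n m0; nia.
Qed.

Section Constants.
Variables h d k n : nat.
Hypotheses (h_gt0 : 0 < h) (d_gt0 : 0 < d).

(* T is cut into at most 3k pieces of at most d n / k vertices, and C lies between
   [density * k] and [2 * density * k].  A block then carries O(n / k) edges, few
   compared with the n / h unused colours, while two sets of [expansion_size]
   vertices have more edges between them than the union bound over all pairs of
   subsets of a block requires. *)
Definition slack := 4 * h * (2 * d + 8).
Definition density := 144 * (slack * slack) * h * (d + 1).
Definition least_pieces := 64 * h * density * ((d + 1) * (d + 1)) + d.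
Definition expansion_size := n %/ (k * slack).
Definition piece_size := n %/ k.
Definition edge_limit := n %/ (2 * h).

Hypothesis k_big : least_pieces <= k.
Hypothesis n_big : 4 * density * k <= n.
Local Notation g := slack.
Local Notation L := density.
Local Notation a := expansion_size.
Local Notation t := piece_size.
Local Notation b := edge_limit.

Lemma slack_ge : 8 * h <= g.
Proof. by rewrite /slack; nia. Qed.

Lemma slack_gt0 : 0 < g.
Proof. by have := slack_ge; lia. Qed.

Lemma density_ge : 8 * h * g <= L.
Proof.
have g0 := slack_gt0; rewrite /density.
have : 1 * g <= g * g by rewrite leq_mul2r g0 orbT.
move: (g * g) => gg le; have : h * g <= h * gg by rewrite leq_mul2l; lia.
nia.
Qed.

Lemma density_gt0 : 0 < L.
Proof. by have := density_ge; have := slack_gt0; nia. Qed.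

Lemma k_gt0 : 0 < k.
Proof. by move: k_big; rewrite /least_pieces; lia. Qed.

Lemma kg_le : k * g <= n.
Proof.
apply: leq_trans n_big; rewrite mulnC leq_mul2r; apply/orP; right.
by have := density_ge; nia.
Qed.

Lemma expansion_size_le : k * g * a <= n.
Proof. by rewrite mulnC leq_trunc_div. Qed.

Lemma expansion_size_ge : n <= 2 * (k * g) * a.
Proof.
apply: divn_half kg_le; by rewrite muln_gt0 k_gt0 slack_gt0.
Qed.

Lemma n_gt0 : 0 < n.
Proof. by have := kg_le; have := k_gt0; have := slack_gt0; nia. Qed.

Lemma expansion_size_gt0 : 0 < a.
Proof. by have := expansion_size_ge; have := n_gt0; case: a => //; rewrite muln0; lia. Qed.

Lemma piece_size_le : k * t <= n.
Proof. by rewrite mulnC leq_trunc_div. Qed.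

Lemma k_le_n : k <= n.
Proof. by apply: leq_trans kg_le; rewrite leq_pmulr ?slack_gt0. Qed.

Lemma piece_size_ge : n <= 2 * k * t.
Proof. exact: divn_half k_gt0 k_le_n. Qed.

Lemma piece_size_gt0 : 0 < t.
Proof. by rewrite divn_gt0 ?k_gt0 // k_le_n. Qed.

(** As [n] is at most [2kt], there are at most [2k + d] pieces; the summand [d] in [least_pieces]
    makes this at most [3k]. *)
Lemma pieces_le s N : N <= n -> s * t <= N + t * d -> s <= 3 * k.
Proof.
move=> Nn st; have := piece_size_ge; have := piece_size_gt0.
have : d <= k by apply: leq_trans k_big; apply: leq_addl.
move=> dk t0 nt; rewrite -(leq_pmul2r t0) (leq_trans st) //.
by move: (t) nt t0 => u; nia.
Qed.

(** The origin of [slack]: at most [4k] blocks, each with [(2d+8)a] spare vertices, must fit into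
    the [n/h] vertices that the tree leaves over. *)
Lemma blocks_fit s N : h * N + n <= h * n -> s <= 3 * k ->
  N + s.+1 * ((2 * d + 8) * a) <= n.
Proof.
move=> Nn s3; rewrite -(leq_pmul2l h_gt0) mulnDr.
apply: leq_trans Nn; rewrite leq_add2l; apply: leq_trans expansion_size_le.
have k0 := k_gt0.
rewrite /slack; have : s.+1 <= 4 * k by lia.
move=> s4.
have -> : h * (s.+1 * ((2 * d + 8) * a)) = s.+1 * (h * (2 * d + 8) * a) by lia.
have -> : k * (4 * h * (2 * d + 8)) * a = 4 * k * (h * (2 * d + 8) * a) by lia.
by rewrite leq_mul2r s4 orbT.
Qed.

Lemma block_card_le P W : P <= d * t -> W = P + (2 * d + 8) * a -> k * W <= (d + 1) * n.
Proof.
move=> Pt ->; have -> : (d + 1) * n = d * n + n by lia.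
rewrite mulnDr leq_add //.
  by have := piece_size_le; move: (t) Pt => u; nia.
apply: leq_trans expansion_size_le; rewrite mulnA leq_mul2r; apply/orP; right.
by rewrite leq_mul2l /slack; apply/orP; right; nia.
Qed.

(** With [theta = C/(2hn)] and [C] at least [L * k], this many edges make [(1 - theta)^z] at most
    one half. *)
Definition half_exponent := (2 * h * n) %/ (L * k) + 1.
Local Notation z := half_exponent.

Lemma Lk_gt0 : 0 < L * k.
Proof. by rewrite muln_gt0 density_gt0 k_gt0. Qed.

Lemma half_exponent_ge : 2 * h * n <= L * k * z.
Proof. by rewrite /half_exponent addn1 [leqRHS]mulnC ltnW // ltn_ceil ?Lk_gt0. Qed.

Lemma half_exponent_le : L * k * z <= 4 * h * n.
Proof.
rewrite /half_exponent mulnDr muln1.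
have : L * k * (2 * h * n %/ (L * k)) <= 2 * h * n by rewrite mulnC leq_trunc_div.
have : L * k <= h * n.
  by apply: leq_trans (leq_pmull _ h_gt0); apply: leq_trans n_big; nia.
lia.
Qed.

Lemma half_exponent_le_size : z <= a.
Proof.
rewrite -(leq_pmul2l Lk_gt0); apply: leq_trans half_exponent_le _.
apply: (@leq_trans (4 * h * (2 * (k * g) * a))).
  by rewrite leq_mul2l expansion_size_ge orbT.
have -> : 4 * h * (2 * (k * g) * a) = 8 * h * g * (k * a) by lia.
by rewrite -[leqRHS]mulnA leq_mul2r density_ge orbT.
Qed.

(** Two sets of size [a] span at least [a^2/3] edges, and failure probability [8^-W] needs [3zW] of
    them. Since [a] is at least [n/(2kg)], [z] at most [4hn/(Lk)] and [W] at most [(d+1)n/k], the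
    factor 144 in [density] is [9 * 4 * 4]. *)
Lemma half_exponent_square W : k * W <= (d + 1) * n -> 3 * (z * (3 * W)) <= a * a.
Proof.
move=> kW.
have Lg0 : 0 < L * (2 * (k * g) * (2 * (k * g))).
  have kg0 : 0 < 2 * (k * g) by have := k_gt0; have := slack_gt0; nia.
  by rewrite muln_gt0 density_gt0 muln_gt0 kg0.
rewrite -(leq_pmul2l Lg0).
apply: (@leq_trans (L * (n * n))); last first.
  have := leq_mul expansion_size_ge expansion_size_ge.
  move=> le; rewrite -[leqRHS]mulnA leq_mul2l; apply/orP; right; apply: leq_trans le _.
  by apply: eq_leq; lia.
have := leq_mul half_exponent_le kW; move=> le.
have -> : L * (2 * (k * g) * (2 * (k * g))) * (3 * (z * (3 * W)))
  = 36 * (g * g) * (L * k * z * (k * W)) by lia.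
apply: leq_trans (_ : 36 * (g * g) * (4 * h * n * ((d + 1) * n)) <= _).
  by rewrite leq_mul2l le orbT.
by apply: eq_leq; rewrite /density; lia.
Qed.

(** As [p] is at most [2Lk/n], this is an exponent [y] with [(1 + p)^y] at most 2. *)
Definition double_exponent := n %/ (4 * L * k).
Local Notation y := double_exponent.

Lemma double_exponent_le : 4 * L * k * y <= n.
Proof. by rewrite mulnC leq_trunc_div. Qed.

(** The at most [W * W] edges in a block split into [q] batches of [y], each contributing a factor
    at most 2 to the exponential moment. The factor 64 in [least_pieces] makes [q] about [n/(8h)],
    so that [q + a] stays below [b]. *)
Lemma inner_limit W : k * W <= (d + 1) * n ->
  exists2 q, W * W <= y * q & q + a <= b.
Proof.
move=> kW.
have hn : 8 * h <= n.
  by apply: leq_trans kg_le; have := slack_ge; have := k_gt0; nia.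
pose q := (8 * L * ((d + 1) * (d + 1)) * n) %/ k + 1.
have k0 := k_gt0; exists q.
  have kq : 8 * L * ((d + 1) * (d + 1)) * n <= k * q.
    by rewrite /q [_ %/ k + 1]addn1 [leqRHS]mulnC ltnW // ltn_ceil.
  have ny : n <= 2 * (4 * L * k) * y.
    by apply: divn_half n_big; rewrite -mulnA muln_gt0 Lk_gt0.
  have kk : 0 < k * k by rewrite muln_gt0 k0.
  rewrite -(leq_pmul2l kk).
  have -> : k * k * (W * W) = k * W * (k * W) by lia.
  apply: leq_trans (leq_mul kW kW) _.
  have -> : (d + 1) * n * ((d + 1) * n) = (d + 1) * (d + 1) * n * n by lia.
  apply: leq_trans (leq_mul (leqnn ((d + 1) * (d + 1) * n)) ny) _.
  have -> : (d + 1) * (d + 1) * n * (2 * (4 * L * k) * y)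
    = k * y * (8 * L * ((d + 1) * (d + 1)) * n) by lia.
  apply: leq_trans (leq_mul (leqnn (k * y)) kq) _.
  by apply: eq_leq; lia.
have q_le : 8 * h * q <= n + 8 * h.
  rewrite -(leq_pmul2l k0) /q.
  have := leq_trunc_div (8 * L * ((d + 1) * (d + 1)) * n) k.
  set u := _ %/ k => uk.
  have : 8 * h * (8 * L * ((d + 1) * (d + 1)) * n) <= k * n.
    apply: (@leq_trans (64 * h * L * ((d + 1) * (d + 1)) * n)).
      by apply: eq_leq; lia.
    rewrite leq_mul2r; apply/orP; right; apply: leq_trans k_big.
    by rewrite /least_pieces leq_addr.
  have := leq_mul (leqnn (8 * h)) uk; move: (8 * L * _ * n) => v h1 h2.
  by nia.
have a_le : 8 * h * a <= n.
  apply: leq_trans expansion_size_le; rewrite leq_mul2r; apply/orP; right.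
  by apply: leq_trans slack_ge _; rewrite leq_pmull.
have b_ge : n < (b + 1) * (2 * h) by rewrite addn1 ltn_ceil // muln_gt0.
by move: q_le a_le b_ge; clearbody q; clear -h_gt0 hn; move: a b => a' b'; nia.
Qed.

End Constants.

(** * The probability bound *)

Local Open Scope ring_scope.

Lemma sum_card_fibers (T : finType) (s : nat) (pc : T -> nat) :
  (forall v, (pc v <= s)%N) -> (\sum_(j < s.+1) #|piece pc j| = #|T|)%N.
Proof.
move=> le; rewrite -sum1_card (partition_big (fun v : T => @inord s (pc v)) xpredT) //=.
apply: eq_bigr => j _; rewrite -sum1_card; apply: eq_bigl => v.
by rewrite inE -val_eqE /= inordK // ltnS.
Qed.

Lemma rainbow_tree_prob (R : realType) (h d k m n : nat) (C : R) (T G : sgraph) :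
  (0 < h)%N -> (0 < d)%N -> (least_pieces h d <= k)%N -> (4 * density h d * k <= n)%N ->
  (density h d * k)%:R <= C -> C <= (2 * density h d * k)%:R ->
  (2000 * (k * k) * slack h d + option_count m (3 * k) * (3 * k).+1
    <= expansion_size h d k n)%N ->
  is_tree T -> (h * #|T| + n <= h * n)%N -> max_degree T = d ->
  #|G| = n -> pseudorandom G ->
  1 - (3 * k)%:R * ((option_count m (3 * k)).+1%:R * 2^-1 ^+ expansion_size h d k n + 2^-1 ^+ m)
    <= coloured_Gp_prob (G := G) (K := 'I_n) (C / n%:R) (fun H c => has_rainbow_copy T H c).
Proof.
move=> h0 d0 kbig nbig Clow Chigh abig treeT Tn dT cG psr.
set g := slack h d in abig *; set L := density h d in nbig Clow Chigh *.
set a := expansion_size h d k n in abig *.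
set t := piece_size k n; set b := edge_limit h n.
have a0 : (0 < a)%N by apply: expansion_size_gt0.
have n0 : (0 < n)%N by apply: (@n_gt0 h d k).
have [rt [par [depth [rootT adj_par adjP]]]] := tree_rooting treeT.
have children_le v : (#|children rt par v| <= d)%N.
  rewrite -dT; apply: leq_trans (degree_le_max v); apply/subset_leq_card/subsetP=> u.
  by rewrite !inE => /andP[ur /eqP<-]; apply: adj_par.
have t0 : (0 < t)%N by apply: (@piece_size_gt0 h d).
have [s [pc [rc cutT]]] : exists s pc rc, cutting rt par d t [set: T] s pc rc.
  by apply: (cut_exists rootT) => // v; rewrite !inE.
have Tn' : (#|T| <= n)%N by move: Tn h0; clear; nia.
have s3 : (s <= 3 * k)%N.
  apply: (@pieces_le h d k n h0 d0 kbig nbig s #|T| Tn'); rewrite -/t.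
  apply: leq_trans (cutting_number cutT) _; rewrite cardsT leq_add2l leq_mul2l.
  by rewrite (leq_trans (subset_leq_card (subsetIr _ _)) (children_le rt)) orbT.
pose sz j := (#|piece pc j| + (2 * d + 8) * a)%N.
have [|blk blkE _] := @blocks_exist G s.+1 sz.
  rewrite cG big_split /= sum_card_fibers; last exact: pc_le cutT.
  rewrite sum_nat_const card_ord; exact: blocks_fit.
have cW j : (j <= s)%N -> #|block blk j| = sz j by move=> js; apply: blkE.
have room j : (0 < j <= s)%N -> (#|piece pc j| + (2 * d + 8) * a <= #|block blk j|)%N.
  by case/andP=> _ js; rewrite cW.
have kW j : (0 < j <= s)%N -> (k * #|block blk j| <= (d + 1) * n)%N.
  move=> js; apply: (@block_card_le h d k n) (_ : (#|piece pc j| <= d * t)%N) _ => //.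
    apply: leq_trans (cutting_size cutT js); apply/subset_leq_card/subsetP=> v.
    by rewrite !inE.
  by case/andP: js => _ js; rewrite cW.
pose Bad := \bigcup_(j < s.+1 | (0 < j)%N) low_degree (block blk j).
(* Each of at most [4k] blocks has at least [a] vertices, so it contributes at most [250n/a]
   low-degree vertices, and [n/a] is at most [2kg]. *)
have cBad : (#|Bad| <= 2000 * (k * k) * g)%N.
  rewrite -(leq_pmul2r a0).
  apply: (@leq_trans (\sum_(j < s.+1 | (0 < j)%N) #|low_degree (block blk j)| * a)).
    by rewrite -big_distrl /= leq_mul2r card_bigcup_leq orbT.
  apply: (@leq_trans (\sum_(j < s.+1) 250 * n)).
    rewrite [leqRHS](bigID (fun j : 'I_s.+1 => (0 < j)%N)) /=.
    apply: leq_trans (leq_addr _ _); apply: leq_sum => j j0.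
    have G0 : (0 < #|G|)%N by rewrite cG.
    have := low_degree_few (block blk j) G0 psr; rewrite cG => /ltnW; apply: leq_trans.
    rewrite leq_mul2l; apply/orP; right.
    have js : (0 < j <= s)%N by rewrite j0 -ltnS ltn_ord.
    by apply: leq_trans (room j js); rewrite -[leqLHS]mul1n; clear; nia.
  rewrite sum_nat_const card_ord.
  have := expansion_size_ge h0 d0 kbig nbig; rewrite -/a -/g.
  have := k_gt0 h0 d0 kbig nbig.
  move: s3; clear => s3 k0 na.
  apply: (@leq_trans (4 * k * (250 * n))); first by rewrite leq_mul2r; lia.
  have -> : (4 * k * (250 * n) = 1000 * k * n)%N by lia.
  apply: leq_trans (leq_mul (leqnn (1000 * k)) na) _; apply: eq_leq; lia.
have ocs : (option_count m s <= option_count m (3 * k))%N by apply: option_count_mono.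
have few : (#|Bad| + option_count m s * s.+1 <= a)%N.
  by apply: leq_trans abig; rewrite leq_add // leq_mul.
have initial : (option_count m s <= #|block blk 0 :\: Bad|)%N.
  have : (#|block blk 0| <= #|block blk 0 :\: Bad| + #|Bad|)%N.
    by rewrite -(cardsID Bad (block blk 0)) addnC leq_add2l subset_leq_card ?subsetIr.
  rewrite cW // /sz; move: few a0; clear; nia.
pose p := C / n%:R; pose theta := p / (2 * h)%:R.
have nR : 0 < n%:R :> R by rewrite ltr0n.
have hR : 0 < (2 * h)%:R :> R by rewrite ltr0n muln_gt0.
have C_ge0 : 0 <= C by apply: le_trans Clow.
have p_ge0 : 0 <= p by rewrite divr_ge0.
have p_le1 : p <= 1.
  rewrite ler_pdivrMr // mul1r (le_trans Chigh) // ler_nat (leq_trans _ nbig) //.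
  by rewrite -!mulnA leq_mul2r orbT.
have theta_ge0 : 0 <= theta by rewrite divr_ge0.
have theta_le1 : theta <= 1.
  rewrite ler_pdivrMr // mul1r (le_trans p_le1) // ler1n muln_gt0 h0.
  by [].
have theta_le (D : {set 'I_n}) : (#|'I_n| <= #|D| + #|T| + b)%N ->
    theta <= p * #|D|%:R / #|'I_n|%:R.
  rewrite card_ord => nD; rewrite -mulrA ler_wpM2l // ler_pdivlMr // mulrC.
  rewrite ler_pdivrMr // -natrM ler_nat.
  have : (b * (2 * h) <= n)%N by apply: leq_trunc_div.
  by move: nD Tn h0; clear; nia.
set z := half_exponent h d k n.
have Th z1 : (z <= z1)%N -> (1 - theta) ^+ z1 <= 2^-1.
  move=> zz; apply: (@le_trans _ _ ((1 - theta) ^+ z)).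
    by rewrite ler_wiXn2l ?subr_ge0 ?gerBl.
  apply: expr_le_half => //; rewrite /theta /p !mulrA ler_pdivlMr // ler_pdivlMr //.
  rewrite mul1r; apply: (@le_trans _ _ (z%:R * (L * k)%:R)); last first.
    by rewrite ler_wpM2l.
  have := half_exponent_ge h0 d0 kbig nbig; rewrite -/z -/L => zge.
  by rewrite -!natrM ler_nat (leq_trans zge) // mulnC.
have theta_half : (1 - theta) ^+ a <= 2^-1 by apply: Th; apply: half_exponent_le_size.
have degree_block x j : (0 < j <= s)%N -> blk x != j -> x \notin Bad ->
    (#|block blk j| <= 3 * #|[set y in block blk j | adj x y]|)%N.
  move=> js xj; rewrite leqNgt; apply: contra => lt; apply/bigcupP.
  have [j0 js'] := andP js; exists (Ordinal (js' : (j < s.+1)%N)) => //.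
  by rewrite inE lt inE xj.
have many_between j : (0 < j <= s)%N -> forall A A' : {set G}, [disjoint A & A'] ->
    (a <= #|A|)%N -> (a <= #|A'|)%N ->
    (1 - theta) ^+ #|between A A'| <= 2^-1 ^+ (3 * #|block blk j|).
  move=> js A A' dA aA aA'.
  have aa : (a * a <= #|A| * #|A'|)%N by apply: leq_mul.
  have : (#|A| * #|A'| <= 3 * #|between A A'|)%N.
    apply: psr => //; rewrite cG; apply: leq_trans aa.
    have := expansion_size_ge h0 d0 kbig nbig; rewrite -/a -/g.
    have := k_gt0 h0 d0 kbig nbig; move: abig; clear => abig k0 na.
    apply: leq_trans (leq_mul (leqnn 250) na) _.
    rewrite mulnA leq_mul2r; apply/orP; right; apply: leq_trans abig.
    apply: leq_trans (leq_addr _ _).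
    have -> : (250 * (2 * (k * g)) = 500 * (k * g))%N by lia.
    have -> : (2000 * (k * k) * g = 2000 * k * (k * g))%N by lia.
    by rewrite leq_mul2r; lia.
  move=> AB; have := half_exponent_square h0 d0 kbig nbig (kW j js); rewrite -/z -/a => zz.
  have : (z * (3 * #|block blk j|) <= #|between A A'|)%N.
    by move: (leq_trans zz (leq_trans aa AB)); rewrite leq_pmul2l.
  move=> le; apply: (@le_trans _ _ ((1 - theta) ^+ (z * (3 * #|block blk j|)))).
    by rewrite ler_wiXn2l ?subr_ge0 ?gerBl.
  rewrite exprM; apply: lerXn2r; rewrite ?nnegrE ?exprn_ge0 ?invr_ge0 ?subr_ge0 //.
  exact: Th.
have few_inner j : (0 < j <= s)%N ->
    (1 + p) ^+ #|inner (block blk j)| / 2 ^+ b <= 2^-1 ^+ a.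
  move=> js; have [q Wq qa] := inner_limit h0 d0 kbig nbig (kW j js).
  set y := double_exponent h d k n in Wq.
  have p1 : 1 <= 1 + p by rewrite lerDl.
  have y2 : (1 + p) ^+ y <= 2.
    apply: expr_le_two => //; rewrite /p mulrA ler_pdivrMr //.
    apply: (@le_trans _ _ (y%:R * (2 * L * k)%:R)); first by rewrite ler_wpM2l.
    rewrite [leRHS]mulrC ler_pdivlMr // -!natrM ler_nat.
    have := double_exponent_le h d k n; rewrite -/y -/L; clear; lia.
  have le : (1 + p) ^+ #|inner (block blk j)| <= 2 ^+ q.
    apply: (@le_trans _ _ ((1 + p) ^+ (y * q))).
      by rewrite ler_weXn2l // (leq_trans (inner_card _)).
    rewrite exprM; apply: lerXn2r => //; rewrite nnegrE ?exprn_ge0 //.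
    by apply: le_trans p1.
  rewrite ler_pdivrMr ?exprn_gt0 //; apply: le_trans le _.
  rewrite exprVn mulrC ler_pdivlMr ?exprn_gt0 // -exprD ler_weXn2l //.
  by rewrite ler1n.
have K0 : (0 < #|'I_n|)%N by rewrite card_ord.
have mu0 := edge_mu_ge0 (G := G) (K := 'I_n) p_ge0 p_le1.
have := @stages R G 'I_n T p theta rt par depth d t a s b pc rc blk Bad p_ge0 p_le1 K0
  rootT children_le cutT a0 d0 theta_le theta_ge0 theta_le1 theta_half degree_block room
  m initial few few_inner many_between s (leqnn s).
rewrite coloured_Gp_probE subnn => st.
apply: le_trans (le_trans st _).
  have h2 j : 0 <= (2^-1 : R) ^+ j by rewrite exprn_ge0 ?invr_ge0.
  by rewrite lerB // ler_pM ?ler_nat ?addr_ge0 ?mulr_ge0 // lerD2r ler_wpM2r // ler_nat ltnS.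
apply: prob_le => // w [F [/(_ 0%N isT) pl _]].
exact: placed_rainbow_copy cutT adjP pl.
Qed.

(** * Order of the constants and the limit *)

Local Open Scope ring_scope.

Lemma half_pow_small (R : realType) (c del : R) : 0 < del ->
  exists M, forall a, (M <= a)%N -> c * 2^-1 ^+ a <= del.
Proof.
move=> del0; exists (Num.Def.archi_bound (`|c| / del)) => a Ma.
apply: (@le_trans _ _ (`|c| * 2^-1 ^+ a)).
  by rewrite ler_wpM2r ?exprn_ge0 ?invr_ge0 // ler_norm.
rewrite exprVn ler_pdivrMr ?exprn_gt0 // -ler_pdivrMl // mulrC.
have := archi_boundP (divr_ge0 (normr_ge0 c) (ltW del0)).
move/ltW/le_trans; apply; rewrite -natrX ler_nat (leq_trans Ma) //.
by rewrite ltnW // ltn_expl.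
Qed.

Theorem theorem3p2 (R : realType) (eps : R) (d : nat)
    (eps_gt0 : 0 < eps) (eps_lt1 : eps < 1) (d_ge2 : (2 <= d)%N) :
  exists C0 : R, forall C : R, C0 <= C ->
    forall delta : R, 0 < delta ->
    exists N : nat, forall n : nat, (N <= n)%N ->
    forall T : sgraph, is_tree T -> #|T|%:R <= (1 - eps) * n%:R ->
      max_degree T = d ->
    forall G : sgraph, #|G| = n -> pseudorandom G ->
    1 - delta <=
      coloured_Gp_prob (G := G) (K := 'I_n) (C / n%:R)
        (fun H c => has_rainbow_copy T H c).
Proof.
have d0 : (0 < d)%N by apply: ltnW.
pose h := Num.Def.archi_bound eps^-1.
have eps_h : 1 <= h%:R * eps.
  rewrite -ler_pdivrMr // mul1r; apply/ltW/archi_boundP.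
  by rewrite invr_ge0 ltW.
have h0 : (0 < h)%N.
  by rewrite lt0n; apply/eqP=> hE; move: eps_h; rewrite hE mul0r leNgt ltr01.
set L := density h d; set k0 := least_pieces h d.
have L0 : (0 < L)%N by rewrite /L /density /slack; nia.
have k00 : (0 < k0)%N by rewrite /k0 /least_pieces ltn_addl.
have LR : 0 < L%:R :> R by rewrite ltr0n.
exists (L * k0)%:R => C C0C delta delta0.
(* Rounding down puts [C] between [L * k] and [L * (k + 1)], which is at most [2 * L * k]. *)
pose k := Num.truncn (C / L%:R).
have CL0 : 0 <= C / L%:R by rewrite divr_ge0 // (le_trans _ C0C).
have /andP[kC Ck] := truncn_itv CL0; rewrite -/k in kC Ck.
have k0k : (k0 <= k)%N.
  rewrite -ltnS -(ltr_nat R); apply: le_lt_trans Ck.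
  by rewrite ler_pdivlMr // -natrM mulnC.
have Clow : (L * k)%:R <= C by rewrite mulnC natrM -ler_pdivlMr.
have Chigh : C <= (2 * L * k)%:R.
  move: Ck; rewrite ltr_pdivrMr // => /ltW/le_trans; apply.
  rewrite -natrM ler_nat; have := leq_trans k00 k0k; clear; nia.
have d20 : 0 < delta / 2 by rewrite divr_gt0.
(* [m] depends on [C] and [delta] only, hence so does the number of options; [n] is then taken large
   enough for the terms in [2^-a]. *)
have [m mP] := half_pow_small (3 * k)%:R d20.
pose oc := option_count m (3 * k).
have [M MP] := half_pow_small ((3 * k)%:R * oc.+1%:R) d20.
pose A := (2000 * (k * k) * slack h d + oc * (3 * k).+1 + M)%N.
exists (4 * L * k + A * (k * slack h d))%N => n nN T treeT Tn dT G cG psr.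
have kg0 : (0 < k * slack h d)%N.
  by rewrite muln_gt0 (leq_trans k00 k0k) /slack; move: h0; clear; nia.
have aA : (A <= expansion_size h d k n)%N.
  by rewrite /expansion_size leq_divRL // (leq_trans _ nN) // leq_addl.
have nbig : (4 * L * k <= n)%N by apply: leq_trans nN; apply: leq_addr.
have Tn' : (h * #|T| + n <= h * n)%N.
  rewrite -(ler_nat R) natrD !natrM.
  have := ler_wpM2l (ler0n R h) Tn; have := ler_wpM2r (ler0n R n) eps_h.
  by move: (h%:R : R) (n%:R : R) (#|T|%:R : R) => v x u; lra.
have := rainbow_tree_prob h0 d0 k0k nbig Clow Chigh
  (leq_trans (leq_addr _ _) aA) treeT Tn' dT cG psr.
apply: le_trans; rewrite lerB // [leRHS](splitr delta) mulrDr mulrA.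
rewrite lerD ?mP //; apply: MP.
by apply: leq_trans aA; apply: leq_addl.
Qed.
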